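(* Let $s$ be a positive integer, $\alpha\in\mathbb{R}$, $\omega(t)=\alpha+t^s$, $0<R<1$, $m_0>0$. Let $$\varphi:\ \xi'=e^{i\omega(\xi\eta)}\xi\,(1+p(\xi,\eta)),\quad \eta'=e^{-i\omega(\xi\eta)}\eta\,(1+p(\xi,\eta))^{-1},$$ where $p$ is a power series starting with terms of order at least $2s+1$, converging on $\Delta_R=\{(\xi,\eta)\in\mathbb{C}^2:|\xi|<R,|\eta|<R\}$, with $\|p\|_R:=\max_{|\xi|,|\eta|\le R}|p(\xi,\eta)|\le m_0$. Then there exist positive constants $\epsilon,\delta$ depending only on $R,m_0,s$ such that for any positive integer $n$ the following holds. Write $n\alpha=2g\pi+\beta$ with $g\in\mathbb{Z}$, $-\pi<\beta<\pi$, and let $$\Omega_{n,\epsilon}=\{(\xi,\eta)\in\mathbb{C}^2:\ 0<|\xi|,|\eta|<\epsilon n^{-1/(2s)},\ 1/4<|\xi/\eta|<4\}.$$ If $-\delta<\beta<0$, then the set of fixed points of $\varphi^n$ in $\Omega_{n,\epsilon}$ is the union of $s$ holomorphic curves. Furthermore, if $\varphi$ satisfies $\rho\varphi=\varphi\rho$ with $\rho(\xi,\eta)=(\bar\eta,\bar\xi)$, then the fixed points of $\varphi^n$ in $\Omega_{n,\epsilon}$ lying in the totally real plane $\{\eta=\bar\xi\}$ form a closed real analytic curve. *)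

(* Defs.v *)
(* Complex numbers are mathcomp-real-closed's
   R[i] over a realType R, viewed as a numClosedFieldType (alias Cplx R) so that
   MathComp-Analysis equips it with its standard (normed, topological) structure;
   complex differentiability is `derivable f z 1` with scalars in Cplx R. *)
From HB Require Import structures.
From mathcomp Require Import all_boot all_order all_algebra.
From mathcomp Require Import all_classical all_reals all_analysis.
From mathcomp Require Import complex.

Set Implicit Arguments.
Unset Strict Implicit.
Unset Printing Implicit Defensive.

Import Order.TTheory GRing.Theory Num.Theory.
Import numFieldNormedType.Exports.
Local Open Scope ring_scope.
Local Open Scope classical_set_scope.

Definition Cplx (R : realType) : numClosedFieldType := R[i].

Section Defs.
Variable R : realType.
Local Notation C := (Cplx R).

Definition reC (z : C) : R := complex.Re z.
Definition imC (z : C) : R := complex.Im z.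
Definition modC (z : C) : R := Num.sqrt (reC z ^+ 2 + imC z ^+ 2).
Definition conjC (z : C) : C := ((complex.Re z) +i* (- complex.Im z))%C.
Definition iC : C := (0 +i* 1)%C.
Definition ofR (x : R) : C := (x +i* 0)%C.

Definition expC (z : C) : C :=
  ((expR (reC z) * cos (imC z)) +i* (expR (reC z) * sin (imC z)))%C.

Definition omega (alpha : R) (s : nat) (t : C) : C := ofR alpha + t ^+ s.

Definition bidisk (r : R) : set (C * C) :=
  [set z | modC z.1 < r /\ modC z.2 < r].

Definition psum2 (a : nat -> nat -> C) (x y : C) (N : nat) : C :=
  \sum_(i < N) \sum_(j < N) a i j * x ^+ i * y ^+ j.

Definition abs_psum2 (a : nat -> nat -> C) (x y : C) (N : nat) : R :=
  \sum_(i < N) \sum_(j < N) modC (a i j) * modC x ^+ i * modC y ^+ j.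

Definition phi (alpha : R) (s : nat) (p : C * C -> C) (z : C * C) : C * C :=
  let w := omega alpha s (z.1 * z.2) in
  (expC (iC * w) * z.1 * (1 + p z), expC (- (iC * w)) * z.2 / (1 + p z)).

Definition phi_dom (r : R) (p : C * C -> C) : set (C * C) :=
  [set z | bidisk r z /\ 1 + p z != 0].

(* z is a fixed point of f^n, f defined on dom: all iterates f^k z (k < n)
   lie in dom (so f^n z is defined) and f^n z = z *)
Definition fixed_iter (dom : set (C * C)) (f : C * C -> C * C) (n : nat)
  : set (C * C) :=
  [set z | (forall k, (k < n)%N -> dom (iter k f z)) /\ iter n f z = z].

Definition Omega_set (s n : nat) (eps : R) : set (C * C) :=
  let b := eps * (n%:R) `^ (- (2 * s)%:R^-1) in
  [set z | 0 < modC z.1 < b /\ 0 < modC z.2 < b /\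
           4^-1 < modC (z.1 / z.2) < 4].

Definition rho (z : C * C) : C * C := (conjC z.2, conjC z.1).

Definition totally_real_plane : set (C * C) := [set z | z.2 = conjC z.1].

Definition holomorphic_on (U : set C) (g : C -> C) : Prop :=
  open U /\ forall z, U z -> derivable g z 1.

(* A is a holomorphic curve (a one-dimensional complex submanifold of an open
   subset of C^2): near each of its points, A is the graph of a holomorphic
   function of one of the two coordinates. *)
Definition holomorphic_curve (A : set (C * C)) : Prop :=
  forall z, A z -> exists W : set (C * C), open W /\ W z /\
    exists (U : set C) (g : C -> C), holomorphic_on U g /\
      ((forall w, (A `&` W) w <-> (W w /\ U w.1 /\ w.2 = g w.1)) \/
       (forall w, (A `&` W) w <-> (W w /\ U w.2 /\ w.1 = g w.2))).

Definition union_of_holomorphic_curves (k : nat) (A : set (C * C)) : Prop :=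
  exists Cs : 'I_k -> set (C * C),
    (forall i, Cs i !=set0 /\ connected (Cs i) /\ holomorphic_curve (Cs i)) /\
    (forall i j, i != j -> Cs i `&` Cs j = set0) /\
    (forall w, A w <-> exists i, Cs i w).

Definition real_analytic (f : R -> R) : Prop :=
  forall t0, exists r : R, 0 < r /\ exists c : nat -> R,
    forall t, `|t - t0| < r ->
      (fun N => \sum_(k < N) c k * (t - t0) ^+ k) @ \oo --> f t.

Definition closed_real_analytic_curve (A : set (C * C)) : Prop :=
  exists (gamma : R -> C * C) (T : R), 0 < T /\
    (forall t, gamma (t + T) = gamma t) /\
    (forall t1 t2, 0 <= t1 < T -> 0 <= t2 < T -> gamma t1 = gamma t2 -> t1 = t2) /\
    real_analytic (fun t => reC (gamma t).1) /\
    real_analytic (fun t => imC (gamma t).1) /\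
    real_analytic (fun t => reC (gamma t).2) /\
    real_analytic (fun t => imC (gamma t).2) /\
    (forall t, (fun u => reC (gamma u).1)^`() t != 0 \/
               (fun u => imC (gamma u).1)^`() t != 0 \/
               (fun u => reC (gamma u).2)^`() t != 0 \/
               (fun u => imC (gamma u).2)^`() t != 0) /\
    (forall w, A w <-> exists t, w = gamma t).

End Defs.

(* Main.v *)
(** The product [t = xi eta] is invariant under [phi], so [z = (xi, eta)] with
    [xi <> 0] is fixed by [phi^n] iff [exp (i (beta + n t^s)) P = 1], where [P] is
    the product of the factors [1 + p] along the orbit, and
    [P - 1 = O (n |z|^(2s+1))].  Put [B = - beta].  On [Omega] this equation forces
    [n t^s = B (1 + O (eps))], hence [t = c^2 exp (2 u)] with [u] small and [c] one
    of the [2s]-th roots of [B / n], determined up to sign; this separates the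
    fixed points into [s] pieces.  On each piece [u] is the unique small fixed
    point of a simplified Newton map depending holomorphically on [xi / eta]
    (whence connectedness and, by uniqueness under conjugation, the closed real
    curve) or on [eta] (whence a graph over the [eta]-axis).

    Holomorphy on a disk is replaced by uniform approximability by polynomials.
    This property passes through products, exponentials, [p] and limits of
    iterates, and averaging over roots of unity gives Cauchy's estimates, hence
    Taylor expansions and the Schwarz lemma; the latter turns every bound into a
    Lipschitz bound, so that no derivative is ever estimated. *)
Require Import Defs.
From HB Require Import structures.
From mathcomp Require Import all_boot all_order all_algebra.
From mathcomp Require Import all_classical all_reals all_analysis.
From mathcomp Require Import complex.
From mathcomp Require Import zify ring lra.
Set Implicit Arguments.
Unset Strict Implicit.
Unset Printing Implicit Defensive.
Import Order.TTheory GRing.Theory Num.Theory.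
Import numFieldNormedType.Exports.
Local Open Scope ring_scope.
Local Open Scope classical_set_scope.

(** * Complex modulus and exponential *)

(** The constraint that shapes the estimates is uniformity in [n]. At a point of size [b] the
    accumulated perturbation is of order [n b^(2s+1)]. The condition [1/4 < |xi / eta| < 4] makes
    [b^2] comparable with [|t|], so this is [O(b)] times the main term [n |t|^s]: every error is
    relative, and [n] enters only through [n b^(2s)], which the size condition of [Omega] bounds by
    [eps^(2s)]. At the scale [n |c|^(2s) = B] all errors are proportional to [B]; dividing by the
    Newton derivative [2 s i B] leaves a contraction on a disk whose radius depends on [s] alone.
    [Omega] acts from two sides. It must be small enough that every fixed point in it lies close to
    an unperturbed one, and large enough that its size condition never cuts a curve, which could
    disconnect it. Hence [delta] is chosen after [eps]: it forces [4 |c| < eps n^(-1/(2s))], so that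
    each curve is bounded by the ratio condition alone. The sign of [beta] makes [B] positive, so
    that one branch has [t] near the positive number [|c|^2] and can meet the totally real plane,
    where [t = |xi|^2]. *)

Section ComplexModulus.
Variable R : realType.
Local Notation C := (Cplx R).
Implicit Types (x y : R) (z w h : C).

Lemma modCE z : modC z = Normc.normc z.
Proof. by case: z. Qed.

Lemma normE z : `|z| = ofR (modC z).
Proof. by rewrite /modC /reC /imC normc_def. Qed.

Lemma modC_ge0 z : 0 <= modC z.
Proof. exact: sqrtr_ge0. Qed.

Lemma modC0 : modC (0 : C) = 0.
Proof. by rewrite modCE Normc.normc0. Qed.

Lemma modC1 : modC (1 : C) = 1.
Proof. by rewrite modCE Normc.normc1. Qed.

Lemma modC_eq0 z : (modC z == 0) = (z == 0).
Proof.
apply/eqP/eqP => [|->]; last exact: modC0.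
by rewrite modCE => /Normc.eq0_normc.
Qed.

Lemma modC_gt0 z : (0 < modC z) = (z != 0).
Proof. by rewrite lt_def modC_ge0 andbT modC_eq0. Qed.

Lemma modCM z w : modC (z * w) = modC z * modC w.
Proof. by rewrite !modCE Normc.normcM. Qed.

Lemma modCD z w : modC (z + w) <= modC z + modC w.
Proof. by rewrite !modCE le_normcD. Qed.

Lemma modCN z : modC (- z) = modC z.
Proof. by rewrite !modCE normcN. Qed.

Lemma modCBC z w : modC (z - w) = modC (w - z).
Proof. by rewrite -modCN opprB. Qed.

Lemma modCB z w : modC (z - w) <= modC z + modC w.
Proof. by rewrite (le_trans (modCD _ _))// modCN. Qed.

Lemma modC_dist z w v : modC (z - v) <= modC (z - w) + modC (w - v).
Proof. by rewrite (_ : z - v = (z - w) + (w - v)) ?modCD//; ring. Qed.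

Lemma modCX z n : modC (z ^+ n) = modC z ^+ n.
Proof. by elim: n => [|n ih]; rewrite ?expr0 ?modC1// !exprS modCM ih. Qed.

Lemma modCV z : modC z^-1 = (modC z)^-1.
Proof. by rewrite !modCE Normc.normcV. Qed.

Lemma modC_sum (I : Type) (s : seq I) (P : pred I) (F : I -> C) :
  modC (\sum_(i <- s | P i) F i) <= \sum_(i <- s | P i) modC (F i).
Proof.
elim/big_ind2 : _ => //; first by rewrite modC0.
move=> z a w b za wb; exact: le_trans (modCD _ _) (lerD za wb).
Qed.

Lemma ofR0 : ofR (0 : R) = 0. Proof. by []. Qed.
Lemma ofRD x y : ofR (x + y) = ofR x + ofR y.
Proof. exact: (rmorphD (real_complex R)). Qed.
Lemma ofRM x y : ofR (x * y) = ofR x * ofR y.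
Proof. exact: (rmorphM (real_complex R)). Qed.
Lemma ofRN x : ofR (- x) = - ofR x.
Proof. exact: (rmorphN (real_complex R)). Qed.
Lemma ofRX x n : ofR (x ^+ n) = ofR x ^+ n.
Proof. exact: (rmorphXn (real_complex R)). Qed.
Lemma ofR_nat n : ofR (n%:R : R) = n%:R.
Proof. exact: (rmorph_nat (real_complex R)). Qed.

Lemma modC_ofR x : modC (ofR x) = `|x|.
Proof. by rewrite /modC /= expr0n /= addr0 sqrtr_sqr. Qed.

Lemma modC_nat n : modC (n%:R : C) = n%:R.
Proof. by rewrite -ofR_nat modC_ofR normr_nat. Qed.

Lemma modC_iC : modC (iC R) = 1.
Proof. by rewrite /modC /= expr0n /= add0r expr1n sqrtr1. Qed.

Lemma iC_neq0 : iC R != 0.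
Proof. by rewrite -modC_eq0 modC_iC oner_eq0. Qed.

Lemma reCD z w : reC (z + w) = reC z + reC w.
Proof. by case: z w => [a b] [c d]. Qed.
Lemma imCD z w : imC (z + w) = imC z + imC w.
Proof. by case: z w => [a b] [c d]. Qed.
Lemma reCN z : reC (- z) = - reC z.
Proof. by case: z. Qed.
Lemma imCN z : imC (- z) = - imC z.
Proof. by case: z. Qed.
Lemma reCM z w : reC (z * w) = reC z * reC w - imC z * imC w.
Proof. by case: z w => [a b] [c d]. Qed.
Lemma imCM z w : imC (z * w) = reC z * imC w + imC z * reC w.
Proof. by case: z w => [a b] [c d]. Qed.

Lemma complexP z w : reC z = reC w -> imC z = imC w -> z = w.
Proof. by case: z w => [a b] [c d] /= -> ->. Qed.

Lemma modC_sqr z : modC z ^+ 2 = reC z ^+ 2 + imC z ^+ 2.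
Proof. by rewrite sqr_sqrtr// addr_ge0// sqr_ge0. Qed.

Lemma re_le_modC z : `|reC z| <= modC z.
Proof. by rewrite -sqrtr_sqr ler_wsqrtr// lerDl sqr_ge0. Qed.

Lemma im_le_modC z : `|imC z| <= modC z.
Proof. by rewrite -sqrtr_sqr ler_wsqrtr// lerDr sqr_ge0. Qed.

Lemma modC_le_re_im z : modC z <= `|reC z| + `|imC z|.
Proof.
rewrite -(@ler_pXn2r _ 2)// ?nnegrE ?modC_ge0 ?addr_ge0//.
rewrite modC_sqr -[reC z ^+ 2]real_normK ?num_real//.
rewrite -[imC z ^+ 2]real_normK ?num_real//.
have := normr_ge0 (reC z); have := normr_ge0 (imC z); nra.
Qed.

Lemma complex_eps (e : C) : 0 < e -> exists2 d : R, 0 < d & ofR d = e.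
Proof.
move=> e0; have er : e \is Num.real by rewrite gtr0_real.
exists (reC e); last by have := RRe_real er.
by move: e0; rewrite -{1}(RRe_real er) ltcR.
Qed.

Lemma ofR_gt0 (x : R) : (0 < ofR x :> C) = (0 < x).
Proof. by rewrite -[LHS]/(0 < (x%:C)%C) ltcR. Qed.

Lemma norm_le_ofR (z : C) (x : R) : (`|z| <= ofR x) = (modC z <= x).
Proof. by rewrite normE -[LHS]/((modC z)%:C%C <= (x%:C)%C) lecR. Qed.

Lemma cvgC_epsP (u : nat -> C) (l : C) : u @ \oo --> l ->
  forall e : R, 0 < e -> exists N, forall n, (N <= n)%N -> modC (u n - l) <= e.
Proof.
move=> /cvgrPdist_le + e e0 => /(_ (ofR e)); rewrite ofR_gt0 => /(_ e0) [N _ NP].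
by exists N => n Nn; have := NP n Nn; rewrite /= norm_le_ofR modCBC.
Qed.

Lemma modC_le_eps z : (forall e, 0 < e -> modC z <= e) -> z = 0.
Proof.
move=> H; apply/eqP; rewrite -modC_eq0 eq_le modC_ge0 andbT.
by apply/ler_addgt0Pr => e e0; rewrite add0r H.
Qed.

Lemma geo_half_ev (K e : R) : 0 < e -> exists N, forall n, (N <= n)%N -> K * 2^-1 ^+ n <= e.
Proof.
move=> e0; have K1 : 0 < `|K| + 1 by rewrite ltr_wpDl.
have h : `|2^-1 : R| < 1 by rewrite ger0_norm ?invr_ge0// invf_lt1// ltr1n.
have /cvgrPdist_le /(_ (e / (`|K| + 1))) := @cvg_geometric R 1 _ h.
rewrite divr_gt0// => /(_ isT) [N _ NP]; exists N => n /NP /=.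
rewrite sub0r normrN mul1r ger0_norm ?exprn_ge0 ?invr_ge0// ler_pdivlMr//.
rewrite mulrC; apply: le_trans; rewrite ler_wpM2r ?exprn_ge0 ?invr_ge0//.
by rewrite (le_trans (ler_norm _))// lerDl.
Qed.

(** [u n - 2 K / 2^n] is nondecreasing and [u n + 2 K / 2^n] nonincreasing, so the supremum of the
    former is the limit, with an explicit rate. *)
Lemma geo_cauchy (u : nat -> R) K : (forall n, `|u n.+1 - u n| <= K * 2^-1 ^+ n) ->
  exists l, forall n, `|u n - l| <= 2 * K * 2^-1 ^+ n.
Proof.
move=> uK.
have dec n m : (n <= m)%N -> u n - 2 * K * 2^-1 ^+ n <= u m - 2 * K * 2^-1 ^+ m.
  move=> /subnKC <-; elim: (m - n)%N => [|k ih]; first by rewrite addn0.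
  apply: (le_trans ih); rewrite addnS.
  have := uK (n + k)%N; rewrite ler_norml exprS => /andP[h _].
  move: h; set v := u _; set w := u _; set g := _ ^+ _; lra.
have K0 : 0 <= K.
  by have := uK 0%N; rewrite expr0 mulr1; exact: le_trans.
have g0 n : 0 <= (2^-1 : R) ^+ n by rewrite exprn_ge0// invr_ge0.
have inc n m : (n <= m)%N -> u m + 2 * K * 2^-1 ^+ m <= u n + 2 * K * 2^-1 ^+ n.
  move=> /subnKC <-; elim: (m - n)%N => [|k ih]; first by rewrite addn0.
  apply: (le_trans _ ih); rewrite addnS.
  have := uK (n + k)%N; rewrite ler_norml exprS => /andP[_ h].
  move: h; set v := u _; set w := u _; set g := _ ^+ _; lra.
pose E := [set u n - 2 * K * 2^-1 ^+ n | n in [set: nat]].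
have ub n : ubound E (u n + 2 * K * 2^-1 ^+ n).
  move=> _ [m _ <-]; have K2 : 0 <= 2 * K by rewrite mulr_ge0.
  have [nm|/ltnW mn] := leqP n m.
    apply: le_trans (inc _ _ nm); have := mulr_ge0 K2 (g0 m); lra.
  apply: (le_trans (dec _ _ mn)); have := mulr_ge0 K2 (g0 n); lra.
have E0 : E !=set0 by exists (u 0%N - 2 * K * 2^-1 ^+ 0), 0%N.
have Es : has_sup E by split => //; exists (u 0%N + 2 * K * 2^-1 ^+ 0); exact: ub.
exists (sup E) => n; rewrite ler_norml.
have h1 : sup E <= u n + 2 * K * 2^-1 ^+ n by apply: ge_sup.
have h2 : u n - 2 * K * 2^-1 ^+ n <= sup E by apply: ub_le_sup => //; [exact: Es.2|exists n].
by apply/andP; split; lra.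
Qed.

Lemma geo_cauchyC (u : nat -> C) K : (forall n, modC (u n.+1 - u n) <= K * 2^-1 ^+ n) ->
  exists l, forall n, modC (u n - l) <= 4 * K * 2^-1 ^+ n.
Proof.
move=> uK.
have [|a ha] := @geo_cauchy (fun n => reC (u n)) K.
  by move=> n; rewrite -reCN -reCD; exact: le_trans (re_le_modC _) _.
have [|b hb] := @geo_cauchy (fun n => imC (u n)) K.
  by move=> n; rewrite -imCN -imCD; exact: le_trans (im_le_modC _) _.
exists (Complex a b) => n; apply: (le_trans (modC_le_re_im _)).
rewrite reCD imCD reCN imCN; have := ha n; have := hb n => /=.
by set g := _ ^+ _; lra.
Qed.

End ComplexModulus.

Section ComplexExponential.
Variable R : realType.
Local Notation C := (Cplx R).
Implicit Types (x y a b : R) (z w h : C).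

Lemma re_expC z : reC (expC z) = expR (reC z) * cos (imC z). Proof. by []. Qed.
Lemma im_expC z : imC (expC z) = expR (reC z) * sin (imC z). Proof. by []. Qed.

Lemma expC0 : expC (0 : C) = 1.
Proof. by apply: complexP; rewrite ?re_expC ?im_expC /= expR0 ?cos0 ?sin0 ?mulr1 ?mulr0. Qed.

Lemma expCD z w : expC (z + w) = expC z * expC w.
Proof.
by apply: complexP; rewrite ?(reCM, imCM) ?(re_expC, im_expC) reCD imCD expRD ?cosD ?sinD; ring.
Qed.

Lemma modC_expC z : modC (expC z) = expR (reC z).
Proof.
apply/eqP; rewrite -(@eqrXn2 _ 2)// ?modC_ge0 ?expR_ge0// modC_sqr re_expC im_expC.
by rewrite !exprMn -mulrDr cos2Dsin2 mulr1.
Qed.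

Lemma expC_neq0 z : expC z != 0.
Proof. by rewrite -modC_gt0 modC_expC expR_gt0. Qed.

Lemma expCN z : expC (- z) = (expC z)^-1.
Proof. by apply: (mulfI (expC_neq0 z)); rewrite -expCD subrr expC0 divff ?expC_neq0. Qed.

Lemma expCB z w : expC (z - w) = expC z / expC w.
Proof. by rewrite expCD expCN. Qed.

Lemma expCMn z n : expC (n%:R * z) = expC z ^+ n.
Proof.
elim: n => [|n ih]; first by rewrite mul0r expC0 expr0.
by rewrite exprS -ih -expCD -natr1 mulrDl mul1r addrC.
Qed.

Lemma reC_iM x : reC (iC R * ofR x) = 0.
Proof. by rewrite reCM /=; ring. Qed.

Lemma imC_iM x : imC (iC R * ofR x) = x.
Proof. by rewrite imCM /=; ring. Qed.

Lemma modC_expC_i x : modC (expC (iC R * ofR x)) = 1.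
Proof. by rewrite modC_expC reC_iM expR0. Qed.

Lemma expC_ofR x : expC (ofR x) = ofR (expR x).
Proof. by apply: complexP; rewrite ?re_expC ?im_expC /= ?cos0 ?sin0 ?mulr1 ?mulr0. Qed.

Lemma sin_le_norm b : `|sin b| <= `|b|.
Proof.
wlog b0 : b / 0 <= b => [W|].
  by have [/W//|/ltW] := leP 0 b; rewrite -oppr_ge0 => /W; rewrite sinN !normrN.
have [|c _] := @MVT_segment R sin cos 0 b b0.
  by apply: continuous_subspaceT; exact: continuous_sin.
by rewrite sin0 !subr0 => ->; rewrite normrM ler_piMl// cos_max.
Qed.

Lemma cos_sub1_le b : `|cos b - 1| <= b ^+ 2.
Proof.
wlog b0 : b / 0 <= b => [W|].
  by have [/W//|/ltW] := leP 0 b; rewrite -oppr_ge0 => /W; rewrite cosN sqrrN.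
have [|c] := @MVT_segment R cos (fun x => - sin x) 0 b b0 _.
  by apply: continuous_subspaceT; exact: continuous_cos.
rewrite in_itv /= => /andP[c0 cb].
rewrite cos0 subr0 => ->; rewrite normrM normrN expr2 (ger0_norm b0) ler_wpM2r//.
by rewrite (le_trans (sin_le_norm _))// ger0_norm.
Qed.

Lemma sin_sub_le b : `|b| <= 1 -> `|sin b - b| <= b ^+ 2.
Proof.
wlog b0 : b / 0 <= b => [W|].
  have [/W//|/ltW] := leP 0 b; rewrite -oppr_ge0 => /W; rewrite normrN sinN sqrrN.
  by move=> W1 /W1; rewrite -opprD normrN.
have [|c] := @MVT_segment R (fun x => sin x - x) (fun x => cos x - 1) 0 b b0 _.
  apply: continuous_subspaceT => x; apply: continuousB; [exact: continuous_sin|exact: cvg_id].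
rewrite in_itv /= => /andP[c0 cb].
rewrite sin0 !subr0 => -> b1; rewrite normrM (ger0_norm b0) expr2 ler_wpM2r//.
apply: (le_trans (cos_sub1_le _)); move: b1; rewrite ger0_norm// => b1; nra.
Qed.

(** The upper bound comes from [1 + x <= expR x] at [x = - a], that is [expR a * (1 - a) <= 1]. *)
Lemma expR_quad a : `|a| <= 2^-1 -> `|expR a - 1 - a| <= 2 * a ^+ 2.
Proof.
rewrite ler_norml => /andP[a1 a2].
have h1 := expR_ge1Dx a; have h2 := expR_ge1Dx (- a).
have h3 : expR a * expR (- a) = 1 by rewrite expRxMexpNx_1.
have h4 := expR_gt0 a.
rewrite ger0_norm; last by lra.
have h5 : expR a * (1 - a) <= 1 by rewrite -h3 (ler_pM2l h4); lra.
have : (expR a - 1 - a) * (1 - a) <= a ^+ 2 by nra.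
nra.
Qed.

(** Turns the ratio condition of [Omega_set] into a strip [|Re v| < ln 2] once the ratio is written
    [expC (2 * v)]. *)
Lemma expR_sqr_bounds x : (4^-1 < expR x ^+ 2 < 4) = (`|x| < ln 2).
Proof.
have e4 : 4 = expR (2%:R * ln 2) :> R by rewrite expRM_natl lnK ?posrE// -natrX.
by rewrite -expRM_natl e4 -expRN !ltr_expR ltr_norml; apply/idP/idP => /andP[h1 h2]; apply/andP; split; lra.
Qed.

Lemma expC_quad h : modC h <= 2^-1 -> modC (expC h - 1 - h) <= 4 * modC h ^+ 2.
Proof.
move=> h2; have ha := le_trans (re_le_modC h) h2; have hb := le_trans (im_le_modC h) h2.
apply: (le_trans (modC_le_re_im _)); rewrite modC_sqr.
rewrite !(reCD, reCN, imCD, imCN) re_expC im_expC /=.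
move: ha hb; rewrite -/(reC h) -/(imC h); set a := reC h; set b := imC h => ha hb.
have e1 := expR_quad ha; have c1 := cos_sub1_le b.
have s1 : `|sin b - b| <= b ^+ 2 by apply: sin_sub_le; apply: le_trans hb _; lra.
have s2 := sin_le_norm b.
have k1 : `|expR a * cos b - 1 - a| <= 2 * a ^+ 2 + 3 / 2 * b ^+ 2.
  rewrite (_ : _ - _ - _ = (expR a - 1 - a) * cos b + (1 + a) * (cos b - 1)); last by ring.
  apply: (le_trans (ler_normD _ _)); rewrite !normrM; apply: lerD.
    by rewrite -[leRHS]mulr1 ler_pM// cos_max.
  apply: ler_pM => //; apply: (le_trans (ler_normD _ _)); rewrite normr1; lra.
have k2 : `|expR a * sin b - 0 - b| <= 2 * (`|a| * `|b|) + b ^+ 2.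
  rewrite (_ : _ - _ - _ = (expR a - 1) * sin b + (sin b - b)); last by ring.
  apply: (le_trans (ler_normD _ _)); rewrite normrM; apply: lerD => //.
  rewrite mulrA ler_pM//.
  rewrite (_ : expR a - 1 = (expR a - 1 - a) + a); last by ring.
  apply: (le_trans (ler_normD _ _)).
  have -> : 2 * `|a| = `|a| + `|a| by ring.
  apply: lerD => //; apply: (le_trans e1).
  by rewrite -[a ^+ 2]real_normK ?num_real// expr2; have := normr_ge0 a; nra.
apply: (le_trans (lerD k1 k2)).
rewrite -[a ^+ 2]real_normK ?num_real// -[b ^+ 2]real_normK ?num_real//.
by have := sqr_ge0 (`|a| - `|b|); have := sqr_ge0 (`|b|); have := sqr_ge0 `|a|; nra.
Qed.

Lemma expC_sub1 h : modC h <= 8^-1 -> modC h <= 2 * modC (expC h - 1) /\ modC (expC h - 1) <= 2 * modC h.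
Proof.
move=> h8; have h0 := modC_ge0 h.
have q : modC (expC h - 1 - h) <= 2^-1 * modC h.
  apply: (le_trans (expC_quad _)); first lra.
  by rewrite expr2; nra.
have t1 := modC_dist h (h - (expC h - 1)) 0.
have t2 := modCB (expC h - 1) (expC h - 1 - h).
have e2 : expC h - 1 - (expC h - 1 - h) = h by ring.
have t3 := modCD (expC h - 1 - h) h; have e3 : expC h - 1 - h + h = expC h - 1 by ring.
move: t2 t3; rewrite e2 e3 => t2 t3; split; lra.
Qed.

Lemma angle_exists x y : x ^+ 2 + y ^+ 2 = 1 -> exists t : R, cos t = x /\ sin t = y.
Proof.
move=> xy; have x1 : -1 <= x <= 1.
  by rewrite -ler_norml -(@ler_pXn2r _ 2)// ?nnegrE// real_normK ?num_real// expr1n; have := sqr_ge0 y; lra.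
have cx : cos (acos x) = x by rewrite acosK// in_itv.
have sx : `|y| = sin (acos x) by rewrite sin_acos// -sqrtr_sqr; congr Num.sqrt; lra.
have [y0|y0] := leP 0 y; first by exists (acos x); rewrite cx -sx ger0_norm.
by exists (- acos x); rewrite cosN sinN cx -sx ltr0_norm// opprK.
Qed.

Lemma expC_surj z : z != 0 -> exists w : C, expC w = z.
Proof.
rewrite -modC_gt0 => z0; have m0 : modC z != 0 by rewrite gt_eqF.
have [|t [ct st]] := @angle_exists (reC z / modC z) (imC z / modC z).
  by rewrite !exprMn -mulrDl -modC_sqr exprVn divff// expf_neq0.
exists (Complex (ln (modC z)) t); apply: complexP; rewrite ?re_expC ?im_expC /= lnK ?posrE// ?ct ?st.
  by rewrite mulrCA divff ?mulr1.
by rewrite mulrCA divff ?mulr1.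
Qed.

(** Subtracting the integer part leaves [u] in [[0, 2 pi)]. Cosine is injective on [[0, pi]]; the
    other half is reflected by [u -> 2 pi - u]. *)
Lemma cos_eq1 (t : R) : cos t = 1 -> exists k : int, t = k%:~R * (2 * pi).
Proof.
move=> ct; have pi0 := pi_gt0 R.
have p2 : 0 < 2 * pi :> R by rewrite mulr_gt0.
pose k := Num.floor (t / (2 * pi)).
pose u := t - k%:~R * (2 * pi).
have /andP[k1 k2] := floor_itv (t / (2 * pi)).
have u0 : 0 <= u by rewrite subr_ge0 -ler_pdivlMr.
have u1 : u < 2 * pi.
  by rewrite ltrBlDr -{1}(mul1r (2 * pi)) -mulrDl -ltr_pdivrMr// addrC; move: k2; rewrite intrD.
have per : forall n x, cos (x + (pi *+ 2) *+ n) = cos x.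
  by move=> n x; exact: periodicn (@cosD2pi R) n x.
have cu : cos u = 1.
  rewrite -ct /u; case: (k) => n.
    rewrite -(per n (_ - _)); congr cos.
    rewrite -pmulrn -[_ *+ n]mulr_natr -[pi *+ 2]mulr_natl; ring.
  rewrite -(per n.+1 t); congr cos.
  rewrite NegzE rmorphN/= -pmulrn -[_ *+ n.+1]mulr_natr -[pi *+ 2]mulr_natl; ring.
exists k; apply/eqP; rewrite -subr_eq0 -/u.
have [u2|u2] := leP u pi.
  apply/eqP; apply: (@cos_inj R); rewrite ?in_itv/= ?u0 ?u2 ?lexx ?pi_ge0//.
  by rewrite cu cos0.
have : cos (2 * pi - u) = 1 by rewrite cosB cu mulr_natl cos2pi sin2pi; ring.
move=> c1; have e0 : 2 * pi - u = 0.
  apply: (@cos_inj R); rewrite ?in_itv/= ?lexx ?pi_ge0 ?c1 ?cos0//.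
  by apply/andP; split; lra.
by move: u1; rewrite -subr_gt0 e0 ltxx.
Qed.

Lemma expC_eq1 z : expC z = 1 -> exists k : int, z = iC R * ofR (k%:~R * (2 * pi)).
Proof.
move=> ez; have : modC (expC z) = 1 by rewrite ez modC1.
rewrite modC_expC -{1}expR0 => /expR_inj re0.
have : reC (expC z) = 1 by rewrite ez.
rewrite re_expC re0 expR0 mul1r => /cos_eq1[k kE].
by exists k; apply: complexP; rewrite ?reC_iM ?imC_iM.
Qed.

Lemma expC_2pi (k : int) : expC (iC R * ofR (k%:~R * (2 * pi))) = 1.
Proof.
have e1 : expC (iC R * ofR (2 * pi)) = 1.
  apply: complexP; rewrite ?re_expC ?im_expC reC_iM imC_iM expR0 mul1r mulr_natl.
    by rewrite cos2pi.
  by rewrite sin2pi.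
have en n : expC (iC R * ofR (n%:R * (2 * pi))) = 1.
  by rewrite ofRM ofR_nat mulrCA expCMn e1 expr1n.
case: k => n; first exact: en.
by rewrite NegzE rmorphN/= mulNr ofRN mulrN expCN en invr1.
Qed.

End ComplexExponential.

(** * Uniform limits of polynomials on a disk *)

Section UniformPolynomialApproximation.
Variable R : realType.
Local Notation C := (Cplx R).
Implicit Types (e M rho : R) (w z : C) (f g : C -> C) (q : {poly C}).

(* Membership in the disk algebra; it plays the role of holomorphy on the
   closed disk and yields Taylor expansions without any integration. *)
Definition upoly rho f := forall e, 0 < e ->
  exists q, forall w, modC w <= rho -> modC (f w - q.[w]) <= e.

Lemma eq_upoly rho f g : (forall w, modC w <= rho -> f w = g w) ->
  upoly rho f -> upoly rho g.
Proof. by move=> fg fP e /fP[q qP]; exists q => w wr; rewrite -fg ?qP. Qed.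

Lemma upoly_poly rho q : upoly rho (horner q).
Proof. by move=> e e0; exists q => w _; rewrite subrr modC0 ltW. Qed.

Lemma upoly_cst rho z : upoly rho (fun=> z).
Proof. by apply: eq_upoly (@upoly_poly _ z%:P) => w _; rewrite hornerC. Qed.

Lemma upoly_id rho : upoly rho id.
Proof. by apply: eq_upoly (@upoly_poly _ 'X) => w _; rewrite hornerX. Qed.

Lemma upoly_lim rho f : (forall e, 0 < e ->
    exists2 g, upoly rho g & forall w, modC w <= rho -> modC (f w - g w) <= e) ->
  upoly rho f.
Proof.
move=> H e e0; have e2 : 0 < e / 2 by rewrite divr_gt0.
have [g gP fg] := H _ e2; have [q qP] := gP _ e2; exists q => w wr.
by apply: (le_trans (modC_dist _ (g w) _)); rewrite [leRHS]splitr lerD ?fg ?qP.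
Qed.

Lemma poly_bounded rho q : exists2 M : R, 0 < M & forall w, modC w <= rho -> modC q.[w] <= M.
Proof.
have [rho0|rho0] := ltP rho 0.
  by exists 1 => // w wr; have := le_lt_trans wr rho0; rewrite ltNge modC_ge0.
pose M := \sum_(i < size q) modC q`_i * rho ^+ i.
have M0 : 0 <= M by apply: sumr_ge0 => i _; rewrite mulr_ge0 ?modC_ge0 ?exprn_ge0.
exists (M + 1) => [|w wr]; first by rewrite ltr_wpDl.
rewrite horner_coef (le_trans (modC_sum _ _ _))// -[leLHS]addr0 lerD//.
apply: ler_sum => i _; rewrite modCM modCX ler_wpM2l ?modC_ge0//.
by rewrite lerXn2r// nnegrE modC_ge0.
Qed.

Lemma upoly_bounded rho f : upoly rho f ->
  exists2 M : R, 0 < M & forall w, modC w <= rho -> modC (f w) <= M.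
Proof.
move=> /(_ 1 ltr01)[q qP]; have [M M0 MP] := poly_bounded rho q.
exists (M + 1) => [|w wr]; first by rewrite addr_gt0.
rewrite -(subrK q.[w] (f w)) addrC (le_trans (modCD _ _))// lerD ?MP ?qP//.
Qed.

Lemma upolyD rho f g : upoly rho f -> upoly rho g -> upoly rho (fun w => f w + g w).
Proof.
move=> fP gP e e0; have e2 : 0 < e / 2 by rewrite divr_gt0.
have [q qP] := fP _ e2; have [q' qP'] := gP _ e2; exists (q + q') => w wr.
rewrite hornerD (_ : _ - _ = (f w - q.[w]) + (g w - q'.[w])); last by ring.
by rewrite (le_trans (modCD _ _))// [leRHS]splitr lerD ?qP ?qP'.
Qed.

Lemma upolyM rho f g : upoly rho f -> upoly rho g -> upoly rho (fun w => f w * g w).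
Proof.
move=> fP gP e e0; have [M M0 MP] := upoly_bounded fP.
have [q' qP'] := gP (e / 2 / M) ltac:(by rewrite !divr_gt0).
have [N N0 NP] := poly_bounded rho q'.
have [q qP] := fP (e / 2 / N) ltac:(by rewrite !divr_gt0).
exists (q * q') => w wr.
rewrite hornerM (_ : _ - _ = f w * (g w - q'.[w]) + (f w - q.[w]) * q'.[w]); last by ring.
rewrite (le_trans (modCD _ _))// [leRHS]splitr !modCM lerD//.
  have -> : e / 2 = M * (e / 2 / M) by rewrite [RHS]mulrC divfK ?gt_eqF.
  by rewrite ler_pM ?modC_ge0 ?MP ?qP'.
have -> : e / 2 = (e / 2 / N) * N by rewrite divfK ?gt_eqF.
by rewrite ler_pM ?modC_ge0 ?NP ?qP.
Qed.

Lemma upolyN rho f : upoly rho f -> upoly rho (fun w => - f w).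
Proof.
move=> fP; apply: eq_upoly (upolyM (upoly_cst _ (-1)) fP) => w _.
by rewrite mulN1r.
Qed.

Lemma upolyX rho f n : upoly rho f -> upoly rho (fun w => f w ^+ n).
Proof.
move=> fP; elim: n => [|n ih].
  by apply: eq_upoly (upoly_cst _ 1) => w _; rewrite expr0.
by apply: eq_upoly (upolyM fP ih) => w _; rewrite exprS.
Qed.

Lemma upoly_sum rho n (F : nat -> C -> C) : (forall i, upoly rho (F i)) ->
  upoly rho (fun w => \sum_(i < n) F i w).
Proof.
move=> FP; elim: n => [|n ih].
  by apply: eq_upoly (upoly_cst _ 0) => w _; rewrite big_ord0.
by apply: eq_upoly (upolyD ih (FP n)) => w _; rewrite big_ord_recr.
Qed.

(** Telescoping. The factor [M ^+ n] is harmless in the application to [expC], where [M] is of the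
    form [expR (a / n)]. *)
Lemma modC_exprB z w M n : modC z <= M -> modC w <= M -> 1 <= M ->
  modC (z ^+ n - w ^+ n) <= n%:R * modC (z - w) * M ^+ n.
Proof.
move=> zM wM M1; have M0 : 0 <= M by apply: le_trans M1.
elim: n => [|n ih]; first by rewrite !expr0 subrr modC0 !mul0r.
rewrite !exprS (_ : _ - _ = (z - w) * z ^+ n + w * (z ^+ n - w ^+ n)); last by ring.
rewrite (le_trans (modCD _ _))// !modCM modCX -natr1.
rewrite (_ : _ * (M * _) = modC (z - w) * (M * M ^+ n) + M * (n%:R * modC (z - w) * M ^+ n)); last by ring.
apply: lerD; last by rewrite ler_pM ?modC_ge0.
rewrite ler_wpM2l ?modC_ge0// -exprS (@le_trans _ _ (M ^+ n))//.
  by rewrite lerXn2r ?nnegrE ?modC_ge0.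
by rewrite exprS ler_peMl ?exprn_ge0.
Qed.

(** Approximation by [(1 + f / N)^N]: the bases differ by [O(N^-2)], hence the [N]-th powers by
    [O(N^-1)]. *)
Lemma upoly_exp rho f : upoly rho f -> upoly rho (fun w => expC (f w)).
Proof.
move=> fP; have [M M0 MP] := upoly_bounded fP; apply: upoly_lim => e e0.
pose K := 4 * M ^+ 2 * expR M.
have K0 : 0 < K by rewrite !mulr_gt0 ?exprn_gt0 ?expR_gt0.
(* [N > 2 M] brings [f / N] within the range of [expC_quad]; [N > K / e] makes the final error
   [K / N] at most [e]. *)
have [N NP] : exists N : nat, 2 * M + K / e < N%:R.
  by exists (Num.trunc (2 * M + K / e)).+1; rewrite truncnS_gt.
have N0 : 0 < N%:R :> R.
  by apply: lt_trans NP; rewrite addr_gt0 ?divr_gt0// mulr_gt0.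
have NC : (N%:R : C) != 0 by rewrite -modC_gt0 modC_nat.
have Ke : 0 < K / e by rewrite divr_gt0.
exists (fun w => (1 + N%:R^-1 * f w) ^+ N).
  by apply/upolyX/upolyD; [exact: upoly_cst|apply: upolyM => //; exact: upoly_cst].
move=> w wr; have fM := MP w wr.
rewrite -{1}(mulVKf NC (f w)) expCMn; set h := _ * f w.
have hM : modC h <= M / N%:R by rewrite modCM modCV modC_nat mulrC ler_wpM2r// invr_ge0 ltW.
have MN : M / N%:R <= 2^-1 by rewrite ler_pdivrMr//; lra.
have hc : 1 + modC h <= expR (M / N%:R).
  by apply: le_trans (expR_ge1Dx _); rewrite lerD2l.
have h1 : modC (1 + h) <= expR (M / N%:R).
  by apply: le_trans hc; rewrite (le_trans (modCD _ _))// modC1.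
have h2 : modC (expC h) <= expR (M / N%:R).
  by rewrite modC_expC ler_expR; apply: le_trans hM; apply: le_trans (re_le_modC h); rewrite ler_norm.
apply: (le_trans (modC_exprB _ h2 h1 _)).
  by apply: le_trans hc; rewrite lerDl modC_ge0.
rewrite -expRM_natl [_ * (M / _)]mulrC divfK ?gt_eqF//.
rewrite (_ : expC h - (1 + h) = expC h - 1 - h); last by ring.
have q : modC (expC h - 1 - h) <= 4 * (M / N%:R) ^+ 2.
  apply: (le_trans (expC_quad (le_trans hM MN))); rewrite ler_wpM2l//.
  by rewrite lerXn2r ?nnegrE ?modC_ge0// divr_ge0 ?ltW.
apply: (@le_trans _ _ (N%:R * (4 * (M / N%:R) ^+ 2) * expR M)).
  by rewrite ler_wpM2r ?expR_ge0// ler_wpM2l// ltW.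
rewrite (_ : _ * _ = K / N%:R); last by rewrite /K; field; rewrite gt_eqF.
rewrite ler_pdivrMr// -ler_pdivrMl// mulrC; lra.
Qed.

(** Partial sums of the Neumann series in [1 - f], with remainder [(1 - f)^N / f]. *)
Lemma upoly_inv rho f : upoly rho f -> (forall w, modC w <= rho -> modC (f w - 1) <= 2^-1) ->
  upoly rho (fun w => (f w)^-1).
Proof.
move=> fP f1; apply: upoly_lim => e e0.
have [N NP] := geo_half_ev 2 e0.
exists (fun w => \sum_(i < N) (1 - f w) ^+ i).
  apply: (@upoly_sum rho N (fun i w => (1 - f w) ^+ i)) => i; apply/upolyX/upolyD; first exact: upoly_cst.
  exact: upolyN.
move=> w wr; have fw := f1 w wr.
have fg : 2^-1 <= modC (f w).
  have := modC_dist 1 (f w) 0; rewrite !subr0 modC1 modCBC; lra.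
have f0 : f w != 0 by rewrite -modC_gt0; apply: lt_le_trans fg; rewrite invr_gt0.
have -> : (f w)^-1 - \sum_(i < N) (1 - f w) ^+ i = (1 - f w) ^+ N / f w.
  apply: (mulIf f0); rewrite mulrBl mulVf// divfK//.
  rewrite -[RHS](subrK 1) subrX1; ring.
rewrite modCM modCV modCX modCBC mulrC; apply: le_trans (NP N (leqnn _)).
apply: ler_pM; rewrite ?invr_ge0 ?exprn_ge0 ?modC_ge0//.
  by rewrite -[leRHS]invrK lef_pV2// ?posrE ?invr_gt0// (lt_le_trans _ fg)// invr_gt0.
by rewrite lerXn2r// nnegrE ?modC_ge0// invr_ge0.
Qed.

End UniformPolynomialApproximation.

(** * Cauchy estimates, Taylor expansions and the Schwarz lemma *)

Section CauchyEstimates.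
Variable R : realType.
Local Notation C := (Cplx R).
Implicit Types (e M rho theta : R) (w z : C) (f g : C -> C) (q : {poly C}).

Definition unity_root n : C := expC (iC R * ofR (2 * pi / n%:R)).

Lemma unity_rootX n i : (0 < n)%N -> (unity_root n ^+ i == 1) = (n %| i)%N.
Proof.
move=> n0; have nN : n%:R != 0 :> R by rewrite pnatr_eq0 -lt0n.
have powE k : unity_root n ^+ k = expC (iC R * ofR (k%:R * (2 * pi / n%:R))).
  by rewrite /unity_root -expCMn -(@ofR_nat R) mulrCA -ofRM.
apply/eqP/idP => [|/dvdnP[k ->]].
  rewrite powE => /expC_eq1[k kE].
  have := congr1 (@imC R) kE; rewrite !imC_iM => e.
  have ie : i%:R = (k * n%:Z)%:~R :> R.
    have p0 : 2 * pi != 0 :> R by rewrite gt_eqF// mulr_gt0 ?pi_gt0.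
    apply: (mulIf p0); rewrite intrM mulrAC -e -pmulrn.
    by field.
  have /intr_inj ik : (i%:Z)%:~R = (k * n%:Z)%:~R :> R by rewrite -ie -pmulrn.
  by apply/dvdnP; exists `|k|%N; have k0 := congr1 absz ik; rewrite abszM !absz_nat in k0.
rewrite powE (_ : (k * n)%:R * _ = (Posz k)%:~R * (2 * pi)) ?expC_2pi//.
by rewrite natrM -pmulrn; field.
Qed.

(** Orthogonality of the characters of [Z/n]: off the trivial character the geometric sum is killed
    by a nonzero factor. *)
Lemma sum_unity_root n i : (0 < n)%N ->
  \sum_(j < n) (unity_root n ^+ i) ^+ j = (if (n %| i)%N then n%:R else 0).
Proof.
move=> n0; rewrite -(unity_rootX i n0); case: ifPn => [/eqP ->|z1].
  by rewrite (eq_bigr (fun=> 1)) ?sumr_const ?card_ord// => j _; rewrite expr1n.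
have /eqP zn : unity_root n ^+ n == 1 by rewrite unity_rootX.
rewrite -subr_eq0 in z1; apply: (mulfI z1).
by rewrite -subrX1 mulr0 exprAC zn expr1n subrr.
Qed.

(* Averaging over roots of unity replaces the Cauchy integral. *)
Lemma poly_cauchy q rho M k : 0 <= rho -> (forall w, modC w <= rho -> modC q.[w] <= M) ->
  modC q`_k * rho ^+ k <= M.
Proof.
(* [n] exceeds [k] and the degree of [q], so no other coefficient index is congruent to [k] modulo
   [n]. The exponent [n - k] below stands for [- k]. *)
move=> rho0 qM; pose n := maxn (size q) k.+1.
have n0 : (0 < n)%N by rewrite leq_max orbT.
have kn : (k < n)%N by rewrite leq_maxr.
set z := unity_root n.
have z1 : modC z = 1 by exact: modC_expC_i.
have key : \sum_(j < n) q.[ofR rho * z ^+ j] * (z ^+ j) ^+ (n - k) = n%:R * (q`_k * ofR rho ^+ k).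
  under eq_bigr => j _.
    rewrite (horner_coef_wide _ (leq_maxl _ _ : (size q <= n)%N)) mulr_suml.
    under eq_bigr => i _ do rewrite exprMn mulrA -mulrA -exprD -exprM mulnC exprM.
    over.
  rewrite exchange_big /= (bigD1 (Ordinal kn))//= [X in _ + X]big1 ?addr0.
    rewrite -mulr_sumr sum_unity_root// subnKC ?(ltnW kn)// dvdnn mulrC//.
  move=> i /eqP ik; rewrite -mulr_sumr sum_unity_root//; case: ifPn; last by rewrite mulr0.
  move=> ni; case: ik; apply/val_inj => /=; have i_n := ltn_ord i.
  by clearbody n; case/dvdnP: ni => [[|[|d]]]; rewrite ?mul0n ?mul1n ?mulSn; lia.
have : n%:R * (modC q`_k * rho ^+ k) <= n%:R * M.
  rewrite -[n%:R in leLHS](@modC_nat R) -{1}(ger0_norm rho0) -modC_ofR -modCX -!modCM -key.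
  rewrite (le_trans (modC_sum _ _ _))//.
  have -> : n%:R * M = \sum_(j < n) M by rewrite sumr_const card_ord mulr_natl.
  apply: ler_sum => j _; rewrite modCM !modCX z1 !expr1n mulr1 qM//.
  by rewrite modCM modCX z1 expr1n mulr1 modC_ofR ger0_norm.
by rewrite ler_pM2l// ltr0n.
Qed.

(** Cauchy's estimate bounds the [k]-th term by [M theta^k], and [theta <= 1/2] makes the geometric
    sum at most 2. *)
Lemma poly_tail q rho M theta m w : 0 <= rho -> 0 <= theta <= 2^-1 -> modC w <= theta * rho ->
  (forall w, modC w <= rho -> modC q.[w] <= M) ->
  modC (q.[w] - \sum_(k < m) q`_k * w ^+ k) <= 2 * M * theta ^+ m.
Proof.
move=> rho0 /andP[t0 t1] wt qM.
have M0 : 0 <= M by apply: le_trans (qM 0 _); rewrite ?modC_ge0// modC0.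
pose n := maxn (size q) m.
rewrite (horner_coef_wide _ (leq_maxl _ _ : (size q <= n)%N)).
rewrite -(big_mkord xpredT (fun i => q`_i * w ^+ i)) -(big_mkord xpredT (fun i => q`_i * w ^+ i)).
rewrite [X in X - _](@big_cat_nat _ _ _ m 0 n)//= ?leq_maxr// addrAC subrr add0r.
rewrite (le_trans (modC_sum _ _ _))//.
have term k : modC (q`_k * w ^+ k) <= M * theta ^+ k.
  rewrite modCM modCX; apply: (@le_trans _ _ (modC q`_k * (theta * rho) ^+ k)).
    by rewrite ler_wpM2l ?modC_ge0// lerXn2r ?nnegrE ?modC_ge0 ?mulr_ge0.
  by rewrite exprMn mulrCA mulrC ler_wpM2r ?exprn_ge0// poly_cauchy.
apply: (le_trans (ler_sum _ (fun k _ => term k))).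
rewrite -mulr_sumr -mulrA mulrCA ler_wpM2l//.
rewrite -{1}(add0n m) big_addn big_mkord.
under eq_bigr => i _ do rewrite exprD mulrC.
rewrite -mulr_sumr mulrC ler_wpM2r ?exprn_ge0//.
have := subrX1 theta (n - m); have := exprn_ge0 (n - m) t0.
set x := theta ^+ _; set S := \sum_(i < _) _ => x0 e.
have : S * (1 - theta) <= 1.
  rewrite (_ : S * _ = 1 - x) ?lerBlDr ?lerDl//.
  by rewrite mulrC -[LHS]opprK -mulNr opprB -e opprB.
have S0 : 0 <= S by apply: sumr_ge0 => i _; rewrite exprn_ge0.
nra.
Qed.

(** Cauchy's estimate for the difference of consecutive approximants makes each coefficient converge
    geometrically; for fixed [m] the polynomial tail bound then passes to the limit. *)
Lemma upoly_taylor rho M f : 0 < rho -> upoly rho f ->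
  (forall w, modC w <= rho -> modC (f w) <= M) ->
  exists c : nat -> C, forall theta w m, 0 <= theta <= 2^-1 -> modC w <= theta * rho ->
    modC (f w - \sum_(k < m) c k * w ^+ k) <= 2 * M * theta ^+ m.
Proof.
move=> rho0 fP fM; have half n : 0 < (2^-1 : R) ^+ n by rewrite exprn_gt0 ?invr_gt0.
have [Q QP] := choice (fun n => fP _ (half n)).
have QM n w : modC w <= rho -> modC (Q n).[w] <= M + 2^-1 ^+ n.
  move=> wr; have := modC_dist (Q n).[w] (f w) 0; rewrite !subr0 => h; apply: (le_trans h).
  by rewrite addrC lerD ?fM// modCBC QP.
have coef n k : modC ((Q n.+1)`_k - (Q n)`_k) <= 2 / rho ^+ k * 2^-1 ^+ n.
  rewrite mulrAC ler_pdivlMr ?exprn_gt0// -coefB poly_cauchy ?ltW// => w wr.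
  rewrite hornerD hornerN; have := modC_dist (Q n.+1).[w] (f w) (Q n).[w] => h.
  apply: (le_trans h); rewrite mulr_natl mulr2n lerD ?QP// modCBC (le_trans (QP _ _ wr))//.
  by rewrite exprS ler_piMl ?ltW//; lra.
have [c cP] := choice (fun k => geo_cauchyC (coef^~ k)).
exists c => theta w m tt wt; have wr : modC w <= rho.
  apply: (le_trans wt); rewrite ler_piMl ?ltW//; lra.
(* Three errors in units of [2^-n]: 1 for replacing [f] by [Q n], 2 for the excess over [M] in the
   bound on [Q n], and 8 for each of the [m] coefficients. *)
pose K := 1 + 2 + 8 * m%:R : R.
apply/ler_addgt0Pr => e e0; have [n nP] := geo_half_ev K e0.
apply: le_trans (lerD (lexx _) (nP n (leqnn _))).
pose sQ := \sum_(k < m) (Q n)`_k * w ^+ k.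
apply: (le_trans (modC_dist _ (Q n).[w] _)).
apply: (le_trans (lerD (QP n w wr) (modC_dist _ sQ _))).
have h1 := poly_tail m (ltW rho0) tt wt (@QM n).
have h2 : modC (sQ - \sum_(k < m) c k * w ^+ k) <= 8 * m%:R * 2^-1 ^+ n.
  rewrite /sQ -sumrB (le_trans (modC_sum _ _ _))//.
  have -> : 8 * m%:R * 2^-1 ^+ n = \sum_(k < m) 8 * 2^-1 ^+ n :> R.
    by rewrite sumr_const card_ord -mulr_natr; ring.
  apply: ler_sum => k _; rewrite -mulrBl modCM modCX.
  have -> : 8 * 2^-1 ^+ n = (4 * (2 / rho ^+ k) * 2^-1 ^+ n) * rho ^+ k.
    by field; rewrite expf_neq0// gt_eqF.
  by apply: ler_pM; rewrite ?exprn_ge0 ?modC_ge0 ?cP// lerXn2r ?nnegrE ?modC_ge0//; exact: ltW.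
have t1 : theta ^+ m <= 1 by apply: exprn_ile1; lra.
have t0 : 0 <= theta ^+ m by apply: exprn_ge0; lra.
have := half n; move: h1 h2; rewrite /K -/sQ; set g := 2^-1 ^+ n; set A := modC _; set B := modC _.
set T := theta ^+ m in t0 t1 *; nra.
Qed.

Lemma upoly_schwarz rho M f theta w : 0 < rho -> upoly rho f ->
  (forall w, modC w <= rho -> modC (f w) <= M) ->
  0 <= theta <= 2^-1 -> modC w <= theta * rho -> modC (f w - f 0) <= 2 * M * theta.
Proof.
move=> rho0 fP fM tt wt; have [c cP] := upoly_taylor rho0 fP fM.
(* With [theta = 0] the error bound [2 * M * theta ^+ 1] vanishes, which identifies [c 0] with
   [f 0]. *)
have := cP 0 0 1%N; rewrite big_ord1 expr0 mulr1 expr1 mulr0 lexx invr_ge0 ler0n modC0 mul0r lexx.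
move=> /(_ isT isT) h; have f0 : f 0 - c 0%N = 0 by apply/eqP; rewrite -modC_eq0 eq_le h modC_ge0.
have := cP theta w 1%N tt wt; rewrite big_ord1 expr0 mulr1 expr1.
by rewrite -(subrK (c 0%N) (f 0)) f0 add0r.
Qed.

End CauchyEstimates.

(** * Contractions and double power series *)

Section FixedPoints.
Variable R : realType.
Local Notation C := (Cplx R).
Implicit Types (k rho : R) (x y z w : C) (F g : C -> C).

Lemma contraction_unique F k x y :
  (forall x y, modC x <= k -> modC y <= k -> modC (F x - F y) <= 2^-1 * modC (x - y)) ->
  modC x <= k -> modC y <= k -> F x = x -> F y = y -> x = y.
Proof.
move=> lip xk yk Fx Fy; have := lip x y xk yk; rewrite Fx Fy => h.
apply/eqP; rewrite -subr_eq0 -modC_eq0 eq_le modC_ge0 andbT.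
by have := modC_ge0 (x - y); lra.
Qed.

(** The rate depends on [k] alone. When [F] depends on a parameter the iterates therefore converge
    uniformly in it, which carries [upoly] over to the fixed point. *)
Lemma contraction_fixpoint F k : (forall x, modC x <= k -> modC (F x) <= k) ->
  (forall x y, modC x <= k -> modC y <= k -> modC (F x - F y) <= 2^-1 * modC (x - y)) ->
  0 <= k ->
  exists x, [/\ modC x <= k, F x = x & forall n, modC (iter n F 0 - x) <= 4 * k * 2^-1 ^+ n].
Proof.
move=> Fk lip k0; pose u n := iter n F 0.
have uk n : modC (u n) <= k by elim: n => [|n ih]; [rewrite modC0|exact: Fk].
have [n|l ul] := @geo_cauchyC R u k.
  elim: n => [|n ih]; first by rewrite expr0 mulr1 subr0; exact: uk 1%N.
  apply: (le_trans (lip _ _ (uk n.+1) (uk n))); rewrite exprS.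
  by move: ih; rewrite /u /=; set g := _ ^+ _; set m := modC _; lra.
have lk : modC l <= k.
  apply/ler_addgt0Pr => e e0; have [n nP] := geo_half_ev (4 * k) e0.
  have := modC_dist l (u n) 0; rewrite !subr0 modCBC => h; apply: (le_trans h).
  by rewrite addrC lerD// (le_trans (ul n))// nP.
exists l; split => //; apply/eqP; rewrite -subr_eq0; apply/eqP/modC_le_eps => e e0.
have [n nP] := geo_half_ev (4 * k) e0.
apply: (le_trans (modC_dist _ (u n.+1) _)).
have h1 : modC (F l - u n.+1) <= 2^-1 * modC (u n - l) by rewrite modCBC lip.
have := le_trans (ul n) (nP n (leqnn _)); have := le_trans (ul n.+1) (nP n.+1 (leqnSn _)).
have := le_trans (ul n.+2) (nP n.+2 ltac:(lia)).
have : modC (u n.+1 - l) <= 2^-1 * (4 * k * 2^-1 ^+ n).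
  by rewrite (le_trans (ul n.+1))// exprS; lra.
have := nP n (leqnn _); lra.
Qed.

(** Newton's iteration for [expC w = z] with the derivative frozen at 0. Unlike [expC_surj], it
    provides a logarithm controlled by [z - 1]. *)
Lemma local_log z : modC (z - 1) <= 48^-1 ->
  exists2 w : C, expC w = z & modC w <= 2 * modC (z - 1).
Proof.
move=> z1; set k := 2 * modC (z - 1).
have k0 : 0 <= k by rewrite mulr_ge0 ?modC_ge0.
have k24 : k <= 24^-1 by rewrite /k; lra.
pose F w := w - (expC w - z).
have [||//|w [wk Fw _]] := @contraction_fixpoint F k.
- move=> x xk; rewrite /F (_ : _ - _ = (z - 1) - (expC x - 1 - x)); last by ring.
  apply: (le_trans (modCB _ _)).
  have := @expC_quad R x ltac:(lra); have := modC_ge0 x; rewrite expr2 => h1 h2.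
  have : modC (z - 1) = k / 2 by rewrite /k; field.
  nra.
- move=> x y xk yk; set h := x - y.
  have hk : modC h <= 2 * k by apply: (le_trans (modCB _ _)); lra.
  have -> : F x - F y = - ((expC y - 1) * (expC h - 1) + (expC h - 1 - h)).
    rewrite /F (_ : expC x = expC h * expC y); last by rewrite -expCD subrK.
    by rewrite /h; ring.
  rewrite modCN (le_trans (modCD _ _))// modCM.
  have := @expC_quad R h ltac:(lra); have [_ h1] := @expC_sub1 R y ltac:(lra).
  have [_ h2] := @expC_sub1 R h ltac:(lra); rewrite expr2 => h3.
  have := ler_pM (modC_ge0 _) (modC_ge0 _) h1 h2.
  have := modC_ge0 h; have := modC_ge0 y; nra.
exists w => //; apply/eqP; rewrite -subr_eq0; apply/eqP.
by move/eqP: Fw; rewrite /F -subr_eq0 addrAC subrr add0r oppr_eq0 => /eqP.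
Qed.

End FixedPoints.

Section DoublePowerSeries.
Variable R : realType.
Local Notation C := (Cplx R).
Implicit Types (x y z w : C).

(** Both increments run over the same L-shaped set of indices, so termwise domination suffices. *)
Lemma psum2_step (a : nat -> nat -> C) x y (b : R) N : modC x <= b -> modC y <= b ->
  modC (psum2 a x y N.+1 - psum2 a x y N) <=
  abs_psum2 a (ofR b) (ofR b) N.+1 - abs_psum2 a (ofR b) (ofR b) N.
Proof.
move=> xb yb; have b0 : 0 <= b by apply: le_trans xb; exact: modC_ge0.
have T i j : modC (a i j * x ^+ i * y ^+ j) <= modC (a i j) * modC (ofR b) ^+ i * modC (ofR b) ^+ j.
  rewrite !modCM !modCX modC_ofR (ger0_norm b0); apply: ler_pM; rewrite ?mulr_ge0 ?exprn_ge0 ?modC_ge0//.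
    by rewrite ler_wpM2l ?modC_ge0// lerXn2r ?nnegrE ?modC_ge0.
  by rewrite lerXn2r ?nnegrE ?modC_ge0.
have sp (V : nmodType) (F : nat -> nat -> V) : \sum_(i < N) \sum_(j < N.+1) F i j =
    \sum_(i < N) \sum_(j < N) F i j + \sum_(i < N) F i N.
  by rewrite -big_split; apply: eq_bigr => i _; rewrite big_ord_recr.
rewrite /psum2 /abs_psum2 !big_ord_recr /=.
rewrite (sp _ (fun i j => a i j * x ^+ i * y ^+ j)).
rewrite (sp _ (fun i j => modC (a i j) * modC (ofR b) ^+ i * modC (ofR b) ^+ j)).
set A := \sum_(i < N) \sum_(j < N) _; set B := \sum_(i < N) \sum_(j < N) _.
rewrite (_ : forall u v : C, A + u + v - A = u + v); last by move=> u v; ring.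
rewrite (_ : forall u v : R, B + u + v - B = u + v); last by move=> u v; ring.
rewrite (le_trans (modCD _ _))// lerD//.
  by rewrite (le_trans (modC_sum _ _ _))// ler_sum.
by rewrite (le_trans (modCD _ _))// lerD// (le_trans (modC_sum _ _ _))// ler_sum.
Qed.

(** Weierstrass test: at the corner [(b, b)] the absolute sums increase to their supremum and
    dominate all increments on the closed bidisk. *)
Lemma psum2_uniform (a : nat -> nat -> C) (p : C * C -> C) (r b : R) : 0 <= b < r ->
  (forall z : C * C, bidisk r z -> exists M : R, forall N, abs_psum2 a z.1 z.2 N <= M) ->
  (forall z : C * C, bidisk r z -> (fun N => psum2 a z.1 z.2 N) @ \oo --> p z) ->
  forall e, 0 < e -> exists N, forall x y, modC x <= b -> modC y <= b ->
    modC (p (x, y) - psum2 a x y N) <= e.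
Proof.
move=> /andP[b0 br] absP cvP e e0; pose S N := abs_psum2 a (ofR b) (ofR b) N.
have bb : bidisk r (ofR b, ofR b) by rewrite /bidisk /= !modC_ofR ger0_norm.
have [M MP] := absP _ bb; rewrite -/S in MP.
have Es : has_sup (range S).
  by split; [exists (S 0%N), 0%N|exists M => _ [n _ <-]; exact: MP].
have e2 : 0 < e / 2 by rewrite divr_gt0.
have [_ [N _ <-] NP] := sup_adherent e2 Es.
have SE n : S n <= sup (range S) by apply: ub_le_sup; [exact: Es.2|exists n].
exists N => x y xb yb.
have step k : modC (psum2 a x y (N + k) - psum2 a x y N) <= S (N + k)%N - S N.
  elim: k => [|k ih]; first by rewrite addn0 !subrr modC0.
  apply: (le_trans (modC_dist _ (psum2 a x y (N + k)) _)).
  by move: ih; have := @psum2_step a x y b (N + k)%N xb yb; rewrite /S !addnS; lra.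
have bxy : bidisk r (x, y) by split; rewrite /= (le_lt_trans _ br).
have [N' N'P] := cvgC_epsP (cvP _ bxy) e2.
apply: (le_trans (modC_dist _ (psum2 a x y (N + N')) _)).
rewrite [leRHS]splitr lerD//; first by rewrite modCBC N'P// leq_addl.
by rewrite (le_trans (step _))//; have := SE (N + N')%N; lra.
Qed.

Lemma upoly_psum2 (a : nat -> nat -> C) rho X Y N : upoly rho X -> upoly rho Y ->
  upoly rho (fun w => psum2 a (X w) (Y w) N).
Proof.
move=> XP YP; apply: (@upoly_sum R rho N (fun i w => \sum_(j < N) a i j * X w ^+ i * Y w ^+ j)) => i.
apply: (@upoly_sum R rho N (fun j w => a i j * X w ^+ i * Y w ^+ j)) => j.
by apply: upolyM (upolyX _ YP); apply: upolyM (upolyX _ XP); exact: upoly_cst.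
Qed.

(** On a complex line through the origin the total order of the double series becomes the order of
    vanishing of a polynomial in one variable. *)
Lemma psum2_line (a : nat -> nat -> C) m x y N : (forall i j, (i + j < m)%N -> a i j = 0) ->
  exists2 q : {poly C}, (forall w, q.[w] = psum2 a (w * x) (w * y) N) &
    forall k, (k < m)%N -> q`_k = 0.
Proof.
move=> a0; exists (\sum_(i < N) \sum_(j < N) (a i j * x ^+ i * y ^+ j) *: 'X^(i + j)).
  move=> w; rewrite horner_sum; apply: eq_bigr => i _; rewrite horner_sum; apply: eq_bigr => j _.
  by rewrite hornerZ hornerXn !exprMn exprD; ring.
move=> k km; rewrite coef_sum big1// => i _; rewrite coef_sum big1// => j _.
rewrite coefZ coefXn; case: eqP => [kij|]; last by rewrite mulr0.
by rewrite a0 -?kij// !mul0r.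
Qed.

(* Schwarz lemma for [w |-> p (w x, w y)] on the disk of radius [r / (2 b)]. *)
Lemma psum2_small (a : nat -> nat -> C) (p : C * C -> C) (r m0 b : R) m :
  (forall i j, (i + j < m)%N -> a i j = 0) ->
  (forall z : C * C, bidisk r z -> exists M : R, forall N, abs_psum2 a z.1 z.2 N <= M) ->
  (forall z : C * C, bidisk r z -> (fun N => psum2 a z.1 z.2 N) @ \oo --> p z) ->
  (forall z : C * C, bidisk r z -> modC (p z) <= m0) ->
  0 < b -> 4 * b <= r -> forall x y, modC x <= b -> modC y <= b ->
  modC (p (x, y)) <= 2 * m0 * (2 * b / r) ^+ m.
Proof.
move=> a0 absP cvP pM b0 br x y xb yb; have r0 : 0 < r by lra.
pose th := 2 * b / r; have th0 : 0 < th by rewrite divr_gt0 ?mulr_gt0.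
have th2 : th <= 2^-1 by rewrite ler_pdivrMr//; lra.
have r2 : 0 <= r / 2 < r by apply/andP; split; lra.
(* The error [e / K] is counted once between [p] and its partial sum, and [2 th^m] times through the
   bound on that partial sum. *)
pose K := 1 + 2 * th ^+ m; have K0 : 0 < K by rewrite ltr_pwDl// mulr_ge0// exprn_ge0// ltW.
apply/ler_addgt0Pr => e e0.
have eK : 0 < e / K by rewrite divr_gt0.
have [N NP] := psum2_uniform r2 absP cvP eK.
have [q qE q0] := psum2_line x y N a0.
have bth : b * th^-1 = r / 2 by rewrite /th; field; rewrite !gt_eqF.
have scal w v : modC w <= th^-1 -> modC v <= b -> modC (w * v) <= r / 2.
  by move=> wt vb; rewrite modCM mulrC -bth ler_pM ?modC_ge0.
have qM w : modC w <= th^-1 -> modC q.[w] <= m0 + e / K.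
  move=> wt; have x2 := scal _ _ wt xb; have y2 := scal _ _ wt yb.
  rewrite qE -[psum2 _ _ _ _](subrK (p (w * x, w * y))) addrC (le_trans (modCD _ _))//.
  rewrite lerD//; last by rewrite modCBC NP.
  by apply: pM; split => /=; [apply: le_lt_trans x2 _|apply: le_lt_trans y2 _]; lra.
have thr : modC (1 : C) <= th * th^-1 by rewrite modC1 divff// gt_eqF.
have := @poly_tail R q th^-1 (m0 + e / K) th m 1 _ _ thr qM.
rewrite invr_ge0 (ltW th0) th2 => /(_ isT isT).
rewrite big1 ?subr0 => [|k _]; last by rewrite q0 ?mul0r.
rewrite qE !mul1r => h.
have h2 := NP x y ltac:(lra) ltac:(lra).
rewrite -[p _](subrK (psum2 a x y N)) (le_trans (modCD _ _))//.
have -> : e = e / K * K by rewrite divfK// gt_eqF.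
have -> : e / K * K = e / K + 2 * (e / K) * th ^+ m by rewrite {2}/K; ring.
by move: h h2; rewrite -/th; lra.
Qed.

Lemma upoly_psum2_lim (a : nat -> nat -> C) (p : C * C -> C) (r b rho : R) X Y : b < r ->
  (forall z : C * C, bidisk r z -> exists M : R, forall N, abs_psum2 a z.1 z.2 N <= M) ->
  (forall z : C * C, bidisk r z -> (fun N => psum2 a z.1 z.2 N) @ \oo --> p z) ->
  upoly rho X -> upoly rho Y ->
  (forall w, modC w <= rho -> modC (X w) <= b /\ modC (Y w) <= b) ->
  upoly rho (fun w => p (X w, Y w)).
Proof.
(* For [b < 0] the assumption on [X] shows that the disk is empty, and any function qualifies. *)
move=> br absP cvP XP YP XYb; have [b0|b0] := leP 0 b; last first.
  apply: eq_upoly (upoly_cst _ 0) => w /XYb[Xb _].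
  by have := le_lt_trans (le_trans (modC_ge0 _) Xb) b0; rewrite ltxx.
apply: upoly_lim => e e0; have b0r : 0 <= b < r by rewrite b0.
have [N NP] := psum2_uniform b0r absP cvP e0.
exists (fun w => psum2 a (X w) (Y w) N); first exact: upoly_psum2.
by move=> w /XYb[xb yb]; exact: NP.
Qed.

End DoublePowerSeries.

(** * Local expansions and topology *)

Section ConjugationAndRoots.
Variable R : realType.
Local Notation C := (Cplx R).
Implicit Types (z w : C) (x : R).

Lemma conjCM z w : conjC (z * w) = conjC z * conjC w.
Proof. by case: z w => [a b] [c d]; apply: complexP => /=; ring. Qed.

Lemma modC_conj z : modC (conjC z) = modC z.
Proof. by rewrite /modC /= sqrrN. Qed.

Lemma conjCK z : conjC (conjC z) = z.
Proof. by case: z => a b; rewrite /conjC /= opprK. Qed.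

Lemma conjC_ofR x : conjC (ofR x) = ofR x.
Proof. by rewrite /conjC /= oppr0. Qed.

Lemma conjC_expC z : conjC (expC z) = expC (conjC z).
Proof. by apply: complexP; rewrite /= ?cosN// sinN mulrN. Qed.

Lemma mul_conjC z : z * conjC z = ofR (modC z ^+ 2).
Proof.
apply: complexP; rewrite ?reCM ?imCM /= -/(reC z) -/(imC z).
  by rewrite modC_sqr; ring.
by ring.
Qed.

Lemma conjC_real z : conjC z = z -> z = ofR (reC z).
Proof.
move=> /(congr1 (@imC R)) /= h; apply: complexP => //=.
by rewrite -/(imC z) in h *; lra.
Qed.

(** For a logarithm [a] of [z], [s * a] is an integer multiple [k] of [2 pi i]; the remainder of [k]
    modulo [s] is the index. *)
Lemma unity_root_exp (s : nat) z : (0 < s)%N -> z ^+ s = 1 ->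
  exists2 j : nat, (j < s)%N & z = expC (iC R * ofR (2 * pi * j%:R / s%:R)).
Proof.
move=> s0 zs; have z0 : z != 0.
  by apply: contra_eq_neq zs => ->; rewrite expr0n (gtn_eqF s0) eq_sym oner_eq0.
have [a az] := expC_surj z0.
have sN : s%:R != 0 :> R by rewrite pnatr_eq0 -lt0n.
have sC : s%:R != 0 :> C by rewrite pnatr_eq0 -lt0n.
have [|k kE] := @expC_eq1 R (s%:R * a); first by rewrite expCMn az.
pose j := (k %% s)%Z; pose q := (k %/ s)%Z.
have sZ : (s%:Z != 0) by rewrite -lt0n in s0 *; lia.
have j0 : 0 <= j by apply: modz_ge0.
have js : j < s by apply: ltz_pmod.
exists `|j|%N; first by lia.
have aE : a = iC R * ofR (q%:~R * (2 * pi)) + iC R * ofR (2 * pi * `|j|%N%:R / s%:R).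
  apply: (mulfI sC); rewrite kE -mulrDr -ofRD [RHS]mulrCA.
  have -> : s%:R = ofR s%:R :> C by rewrite ofR_nat.
  rewrite -ofRM.
  congr (_ * ofR _).
  have -> : k%:~R = q%:~R * s%:R + `|j|%N%:R :> R.
    have -> : `|j|%N%:R = j%:~R :> R by rewrite -[in RHS](gez0_abs j0) -pmulrn.
    have -> : s%:R = s%:~R :> R by rewrite -pmulrn.
    by rewrite -intrM -intrD -divz_eq.
  by field.
by rewrite -az aE expCD expC_2pi mul1r.
Qed.

End ConjugationAndRoots.

Section LocalExpansions.
Variable R : realType.
Local Notation C := (Cplx R).
Implicit Types (f : R -> C) (F g : C -> C) (w z : C).

(** Stated over a general field because it serves both complex derivatives and those of real and
    imaginary parts along the real line. *)
Lemma quadratic_is_derive (K : numFieldType) (f : K -> K) (x d M rho : K) : 0 < rho -> 0 < M ->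
  (forall h, `|h| <= rho -> `|f (x + h) - (f x + d * h)| <= M * `|h| ^+ 2) ->
  is_derive x 1 f d.
Proof.
move=> rho0 M0 fM.
have cvgd : h^-1 *: (f (h *: (1 : K) + x) - f x) @[h --> 0^'] --> d.
  apply/cvgrPdist_le => e e0; near=> h.
  have h0 : h != 0 by near: h; exact: nbhs_dnbhs_neq.
  have hr : `|h| <= rho by near: h; exact: dnbhs0_le.
  have he : `|h| <= e / M by near: h; apply: dnbhs0_le; rewrite divr_gt0.
  have -> : h *: (1 : K) + x = x + h by rewrite addrC -[h *: 1]/(h * 1) mulr1.
  rewrite -[h^-1 *: _]/(h^-1 * _) distrC.
  rewrite (_ : _ - d = h^-1 * (f (x + h) - (f x + d * h))); last by field.
  have nh : 0 < `|h| by rewrite normr_gt0.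
  rewrite normrM normfV ler_pdivrMl// (le_trans (fM _ hr))// expr2 mulrCA.
  by rewrite ler_pM2l// mulrC -ler_pdivlMr.
by apply: DeriveDef; [apply/cvg_ex; exists d|apply/cvg_lim].
Unshelve. all: by end_near. Qed.

Lemma upoly_quadratic F rho : 0 < rho -> upoly rho F ->
  exists c : nat -> C, exists2 M : R, 0 < M &
    (forall w, modC w <= rho / 2 -> modC (F w - (F 0 + c 1%N * w)) <= M * modC w ^+ 2) /\
    forall w m, modC w <= rho / 2 -> modC (F w - \sum_(k < m) c k * w ^+ k) <= M * 2^-1 ^+ m.
Proof.
move=> rho0 FP; have [M M0 MP] := upoly_bounded FP.
have [c cP] := upoly_taylor rho0 FP MP.
have F0 : F 0 = c 0%N.
  have := cP 0 0 1%N; rewrite big_ord1 expr0 mulr1 expr1 mulr0 lexx invr_ge0 ler0n modC0 mul0r lexx.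
  by move=> /(_ isT isT) h; apply/eqP; rewrite -subr_eq0 -modC_eq0 eq_le h modC_ge0.
exists c; exists (Num.max (2 * M) (2 * M / rho ^+ 2)).
  by rewrite lt_max mulr_gt0.
split=> [w wr|w m wr]; last first.
  apply: (@le_trans _ _ (2 * M * 2^-1 ^+ m)).
    by apply: cP; [rewrite invr_ge0 ler0n lexx|rewrite mulrC].
  by rewrite ler_wpM2r ?exprn_ge0 ?invr_ge0// le_max lexx.
(* Taking [theta = |w| / rho], instead of the worst value 1/2, turns the Taylor error of order two
   into a multiple of [|w|^2]. *)
have hr : modC w <= (modC w / rho) * rho by rewrite divfK// gt_eqF.
have hth : 0 <= modC w / rho <= 2^-1.
  apply/andP; split; first by rewrite divr_ge0 ?modC_ge0// ltW.
  by rewrite ler_pdivrMr// mulrC.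
have := cP _ _ 2%N hth hr.
rewrite !big_ord_recr big_ord0 /= add0r expr0 mulr1 expr1 -F0 => h.
apply: (le_trans h); rewrite (_ : 2 * M * _ = 2 * M / rho ^+ 2 * modC w ^+ 2); last first.
  by field; rewrite gt_eqF.
by rewrite ler_wpM2r ?exprn_ge0 ?modC_ge0// le_max lexx orbT.
Qed.

Lemma upoly_derivable g z (rho : R) : 0 < rho -> upoly rho (fun w => g (z + w)) ->
  derivable g z 1.
Proof.
move=> rho0 gP; have [c [M M0 [q _]]] := upoly_quadratic rho0 gP.
have r2 : 0 < ofR (rho / 2) :> C by rewrite ofR_gt0 divr_gt0.
have M1 : 0 < ofR M :> C by rewrite ofR_gt0.
have H := @quadratic_is_derive C g z (c 1%N) _ _ r2 M1.
apply: (@ex_derive _ _ _ _ _ _ (c 1%N)); apply: H => h.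
by rewrite norm_le_ofR => /q; rewrite addr0 [`|h|]normE -ofRX -ofRM norm_le_ofR.
Qed.

Lemma upoly_continuous g z (rho : R) : 0 < rho -> upoly rho (fun w => g (z + w)) ->
  {for z, continuous g}.
Proof.
move=> rho0 gP; apply: differentiable_continuous.
by apply/derivable1_diffP; exact: upoly_derivable gP.
Qed.

Lemma continuous_line (v : C) : continuous (fun t : R => ofR t * v).
Proof.
move=> t; apply/cvgrPdist_le => e e0.
have [d d0 ed] := complex_eps e0.
have K0 : 0 < modC v + 1 by rewrite ltr_wpDl// modC_ge0.
near=> u.
have h : `|t - u| <= d / (modC v + 1).
  by near: u; apply: cvgr_dist_le; [exact: cvg_id|rewrite divr_gt0].
rewrite -ed -mulrBl -ofRN -ofRD norm_le_ofR modCM modC_ofR.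
apply: (@le_trans _ _ (`|t - u| * (modC v + 1))); first by rewrite ler_wpM2l// lerDl.
by rewrite -ler_pdivlMr.
Unshelve. all: by end_near. Qed.

Lemma upoly_line F f (t : R) (rho : R) : 0 < rho -> upoly rho F ->
    (forall u, `|u - t| <= rho -> f u = F (ofR (u - t))) ->
  exists d : C, is_derive t 1 (fun u => reC (f u)) (reC d) /\
    is_derive t 1 (fun u => imC (f u)) (imC d).
Proof.
move=> rho0 FP fF; have [c [M M0 [q _]]] := upoly_quadratic rho0 FP.
have r2 : 0 < rho / 2 by rewrite divr_gt0.
have key h : `|h| <= rho / 2 -> modC (f (t + h) - (f t + c 1%N * ofR h)) <= M * `|h| ^+ 2.
  move=> hr; rewrite !fF.
  - by rewrite subrr (addrC t) addrK -(modC_ofR h); apply: q; rewrite modC_ofR.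
  - by rewrite subrr normr0 ltW.
  - by rewrite addrC addKr; lra.
exists (c 1%N); split; apply: (quadratic_is_derive r2 M0) => h hr.
  apply: le_trans (key h hr); apply: le_trans (re_le_modC _).
  by rewrite !(reCD, reCN, reCM) /= mulr0 subr0.
apply: le_trans (key h hr); apply: le_trans (im_le_modC _).
by rewrite !(imCD, imCN, imCM) /= mulr0 add0r.
Qed.

Lemma upoly_real_analytic f : (forall t, exists F (rho : R), [/\ 0 < rho, upoly rho F &
    forall u, `|u - t| <= rho -> f u = F (ofR (u - t))]) ->
  real_analytic (fun t => reC (f t)) /\ real_analytic (fun t => imC (f t)).
Proof.
move=> H; suff key t : exists (c : nat -> C) (r : R), 0 < r /\ forall u, `|u - t| < r ->
    forall e, 0 < e -> exists N, forall n, (N <= n)%N ->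
      modC (f u - \sum_(k < n) c k * ofR (u - t) ^+ k) <= e.
  have re_sum (c : nat -> C) (x : R) n :
      reC (\sum_(k < n) c k * ofR x ^+ k) = \sum_(k < n) reC (c k) * x ^+ k.
    elim: n => [|n ih]; first by rewrite !big_ord0.
    by rewrite !big_ord_recr /= reCD ih -ofRX reCM /= mulr0 subr0.
  have im_sum (c : nat -> C) (x : R) n :
      imC (\sum_(k < n) c k * ofR x ^+ k) = \sum_(k < n) imC (c k) * x ^+ k.
    elim: n => [|n ih]; first by rewrite !big_ord0.
    by rewrite !big_ord_recr /= imCD ih -ofRX imCM /= mulr0 add0r.
  split=> t; have [c [r [r0 cP]]] := key t; exists r; split => //.
    exists (fun k => reC (c k)) => u ur; apply/cvgrPdist_le => e e0.
    have [N NP] := cP u ur e e0; exists N => // n /= Nn.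
    by rewrite -re_sum -reCN -reCD; apply: le_trans (re_le_modC _) (NP n Nn).
  exists (fun k => imC (c k)) => u ur; apply/cvgrPdist_le => e e0.
  have [N NP] := cP u ur e e0; exists N => // n /= Nn.
  by rewrite -im_sum -imCN -imCD; apply: le_trans (im_le_modC _) (NP n Nn).
have [F [rho [rho0 FP fF]]] := H t; have [c [M M0 [_ q]]] := upoly_quadratic rho0 FP.
exists c, (rho / 2); split=> [|u ur e e0]; first by rewrite divr_gt0.
have [N NP] := geo_half_ev M e0; exists N => n Nn.
rewrite fF; last by apply: le_trans (ltW ur) _; lra.
by apply: le_trans (NP n Nn); apply: q; rewrite modC_ofR ltW.
Qed.

End LocalExpansions.

Section ComplexTopology.
Variable R : realType.
Local Notation C := (Cplx R).

Lemma modC_dist_norm (z w : C) : `|modC z - modC w| <= modC (z - w).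
Proof.
have h1 := modC_dist z w 0; have h2 := modC_dist w z 0; rewrite !subr0 in h1 h2.
rewrite (modCBC w) in h2; rewrite ler_norml; apply/andP; split; lra.
Qed.

Lemma continuous_modC : continuous (fun z : C => modC z).
Proof.
move=> z; apply/(@cvgrPdist_le R R _ (nbhs z)) => e e0.
have := @cvgr_dist_le C C _ (nbhs z) _ id z cvg_id (ofR e).
rewrite ofR_gt0 => /(_ (nbhs_filter z) e0); apply: filterS => w.
by rewrite norm_le_ofR; apply: le_trans; exact: modC_dist_norm.
Qed.

Lemma continuous_modC_fst : continuous (fun z : C * C => modC z.1).
Proof. by move=> z; apply: continuous_comp; [exact: cvg_fst|exact: continuous_modC]. Qed.

Lemma continuous_modC_snd : continuous (fun z : C * C => modC z.2).
Proof. by move=> z; apply: continuous_comp; [exact: cvg_snd|exact: continuous_modC]. Qed.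

Lemma open_ltf (T : topologicalType) (f g : T -> R) : continuous f -> continuous g ->
  open [set z | f z < g z].
Proof.
move=> fc gc; have -> : [set z | f z < g z] = (g \- f) @^-1` [set x | 0 < x].
  by apply/seteqP; split => z /=; rewrite subr_gt0.
apply: open_comp; last exact: open_gt.
by move=> z _; exact: (cvgB (gc z) (fc z)).
Qed.

Lemma continuous_quad (T : topologicalType) (f : T -> R) : continuous f ->
  continuous (fun z => 4 * f z).
Proof.
move=> fc z; apply: (@continuous_comp _ _ _ f (fun x => 4 * x)); first exact: fc.
exact: mulrl_continuous.
Qed.

Lemma open_annulus (u v : R) : open [set z : C | u < modC z < v].
Proof.
rewrite (_ : [set _ | _] = [set z : C | u < modC z] `&` [set z : C | modC z < v]).
  by apply: openI; apply: open_ltf; try exact: continuous_modC; exact: cst_continuous.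
by apply/seteqP; split => z /=; [move=> /andP[]|case=> -> ->].
Qed.

(** Clearing the denominator of the ratio leaves strict inequalities between functions continuous on
    all of [C^2]. *)
Lemma open_Omega s n (eps : R) : open (Omega_set s n eps).
Proof.
set b := eps * (n%:R : R) `^ (- (2 * s)%:R^-1).
have c1 := continuous_modC_fst; have c2 := continuous_modC_snd.
rewrite (_ : Omega_set s n eps =
  ([set z : C * C | 0 < modC z.1] `&` [set z : C * C | modC z.1 < b]) `&`
  (([set z : C * C | 0 < modC z.2] `&` [set z : C * C | modC z.2 < b]) `&`
   ([set z : C * C | modC z.2 < 4 * modC z.1] `&` [set z : C * C | modC z.1 < 4 * modC z.2]))).
  by apply: openI; [|apply: openI]; apply: openI; apply: open_ltf;
    rewrite //; try exact: continuous_quad; exact: cst_continuous.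
apply/seteqP; split => z /=.
  move=> [/andP[a1 a2] [/andP[b1 b2]]]; rewrite modCM modCV ltr_pdivrMr// ltr_pdivlMr// => /andP[d1 d2].
  by do !split => //; lra.
move=> [[a1 a2] [[b1 b2] [d1 d2]]]; rewrite /Omega_set /= a1 a2 b1 b2; do !split => //.
by rewrite modCM modCV ltr_pdivrMr// ltr_pdivlMr//; apply/andP; split => //; lra.
Qed.

End ComplexTopology.

(** * Orbits and the fixed-point equation *)

Section Dynamics.
Variable R : realType.
Local Notation C := (Cplx R).
Variables (alpha : R) (s : nat) (r Cp : R) (p : C * C -> C).
Implicit Types (w x y : C) (z : C * C) (b rho : R).

(** The expansion of [p] enters the dynamics only through these two properties: stability of [upoly]
    under substitution, and vanishing to order [2s+1] as a bound with constant [Cp]. *)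
Hypothesis p_upoly : forall b rho X Y, b < r -> upoly rho X -> upoly rho Y ->
  (forall w, modC w <= rho -> modC (X w) <= b /\ modC (Y w) <= b) ->
  upoly rho (fun w => p (X w, Y w)).
Hypothesis p_small : forall b, 0 < b -> 4 * b <= r -> forall x y, modC x <= b -> modC y <= b ->
  modC (p (x, y)) <= Cp * b ^+ (2 * s).+1.

Definition rotation z k : C := expC (k%:R * (iC R * omega alpha s (z.1 * z.2))).

(* [perturbation z k] is the product of the factors [1 + p] along the first
   [k] iterates of [z]; since [phi] preserves [z.1 * z.2], the rotation part of
   [phi] stays constant along an orbit. *)
Fixpoint perturbation z k : C :=
  if k is k'.+1 then
    let f := rotation z k' * perturbation z k' in
    perturbation z k' * (1 + p (f * z.1, z.2 / f))
  else 1.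

Definition orbit_pt z k : C * C :=
  let f := rotation z k * perturbation z k in (f * z.1, z.2 / f).

Lemma perturbationS z k : perturbation z k.+1 = perturbation z k * (1 + p (orbit_pt z k)).
Proof. by []. Qed.

Lemma rotation0 z : rotation z 0 = 1.
Proof. by rewrite /rotation mul0r expC0. Qed.

Lemma rotationS z k : rotation z k.+1 = rotation z k * expC (iC R * omega alpha s (z.1 * z.2)).
Proof. by rewrite /rotation -expCD -natr1 mulrDl mul1r. Qed.

(** The factors must be nonzero: with the convention [0^-1 = 0], a vanishing one would destroy the
    invariance of the product of the coordinates. *)
Lemma iter_phi z n : (forall k, (k < n)%N -> 1 + p (orbit_pt z k) != 0) ->
  iter n (phi alpha s p) z = orbit_pt z n.
Proof.
have key k : (k <= n)%N -> (forall k, (k < n)%N -> 1 + p (orbit_pt z k) != 0) ->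
    perturbation z k != 0 /\ iter k (phi alpha s p) z = orbit_pt z k.
  move=> + pn; elim: k => [_|k ih kn].
    by rewrite oner_neq0 /orbit_pt rotation0 /= !mul1r invr1 mulr1 -surjective_pairing.
  have [P0 iterk] := ih (ltnW kn); have p0 := pn _ kn.
  have f0 : rotation z k * perturbation z k != 0 by rewrite mulf_neq0// expC_neq0.
  split; first by rewrite perturbationS mulf_neq0.
  rewrite iterS iterk /phi.
  have -> : (orbit_pt z k).1 * (orbit_pt z k).2 = z.1 * z.2.
    by rewrite /orbit_pt /=; move: f0; set f := _ * perturbation _ _ => f0; field.
  set q := 1 + p (orbit_pt z k).
  rewrite [RHS]/orbit_pt rotationS perturbationS -/q expCN /orbit_pt /=.
  have e0 := expC_neq0 (iC R * omega alpha s (z.1 * z.2)).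
  have r0 := expC_neq0 (k%:R * (iC R * omega alpha s (z.1 * z.2))).
  rewrite -/(rotation z k) in r0.
  congr pair; first by ring.
  by rewrite !invfM; ring.
by move=> pn; have [] := key n (leqnn _) pn.
Qed.

(** Conditions keeping [n] iterates of a point of size [b] within size [2 b]: [8 b <= r] lets
    [p_small] apply there, the third clause bounds the growth caused by the complex rotation, and
    the last one the perturbation accumulated over [n] steps. *)
Definition admissible n b := [/\ 0 < b, 8 * b <= r, n%:R * b ^+ (2 * s) <= 4^-1 &
  2 * n%:R * (Cp * (2 * b) ^+ (2 * s).+1) <= 4^-1].

Definition bounded_by b z := modC z.1 <= b /\ modC z.2 <= b.

Lemma expR_quarter t : t <= 4^-1 -> expR t <= 4 / 3 :> R.
Proof.
move=> t4; have h := expR_ge1Dx (- t); have := expRxMexpNx_1 t; have := expR_gt0 t; nra.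
Qed.

Lemma rotation_bound n b z k : admissible n b -> bounded_by b z -> (k <= n)%N ->
  modC (rotation z k) <= 4 / 3 /\ modC (rotation z k)^-1 <= 4 / 3.
Proof.
move=> [b0 _ nb _] [z1 z2] kn.
have im : `|reC (k%:R * (iC R * omega alpha s (z.1 * z.2)) : C)| <= 4^-1.
  rewrite /omega; set t := (z.1 * z.2) ^+ s.
  have -> : reC (k%:R * (iC R * (ofR alpha + t)) : C) = - (k%:R * imC t).
    rewrite -(@ofR_nat R) !(reCM, imCM, reCD, imCD) /= -/(reC t) -/(imC t); ring.
  rewrite normrN normrM ger0_norm//; apply: le_trans nb.
  apply: ler_pM => //; first by rewrite ler_nat.
  apply: (le_trans (im_le_modC _)); rewrite modCX modCM mulnC exprM expr2.
  rewrite -exprMn lerXn2r ?nnegrE ?mulr_ge0 ?modC_ge0 ?(ltW b0)//.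
  by rewrite ler_pM ?modC_ge0.
move: im; rewrite ler_norml => /andP[h1 h2].
by rewrite /rotation -expCN !modC_expC reCN; split; apply: expR_quarter; lra.
Qed.

(** The two conclusions feed each other: a perturbation within 1/4 of 1, with rotation at most 4/3,
    keeps the point within [2 b], where [p] is at most [mu], which controls the next factor. *)
Lemma orbit_bound n b z k : 0 <= Cp -> admissible n b -> bounded_by b z -> (k <= n)%N ->
  modC (perturbation z k - 1) <= 2 * k%:R * (Cp * (2 * b) ^+ (2 * s).+1) /\
  bounded_by (2 * b) (orbit_pt z k).
Proof.
move=> Cp0 ad zb; have [b0 br nb nmu] := ad.
set mu := Cp * _ in nmu *.
have mu0 : 0 <= mu by rewrite mulr_ge0// exprn_ge0// mulr_ge0// ltW.
have kmu k' : (k' <= n)%N -> 2 * k'%:R * mu <= 4^-1.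
  move=> kn; apply: le_trans nmu; rewrite ler_wpM2r// ler_wpM2l// ler_nat//.
have orb k' : (k' <= n)%N -> modC (perturbation z k' - 1) <= 2 * k'%:R * mu ->
    bounded_by (2 * b) (orbit_pt z k').
  move=> kn P1; have [r1 r2] := rotation_bound ad zb kn; have [z1 z2] := zb.
  have P4 := le_trans P1 (kmu _ kn); set P := perturbation z k' in P4 *.
  have Pu : modC P <= 5 / 4.
    by have := modC_dist P 1 0; rewrite !subr0 modC1; lra.
  have Pl : 3 / 4 <= modC P.
    by have := modC_dist 1 P 0; rewrite !subr0 modC1 modCBC; lra.
  have Pi : modC P^-1 <= 4 / 3.
    have P0 : 0 < modC P by lra.
    rewrite modCV -[leRHS]invrK lef_pV2 ?posrE ?invr_gt0 ?divr_gt0//; lra.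
  rewrite /orbit_pt -/P; split => /=.
    rewrite !modCM; apply: ler_pM; rewrite ?mulr_ge0 ?modC_ge0//.
    have := modC_ge0 P; have := modC_ge0 (rotation z k'); nra.
  rewrite modCM invfM modCM mulrC; apply: ler_pM; rewrite ?mulr_ge0 ?modC_ge0//.
  have := modC_ge0 P^-1; have := modC_ge0 (rotation z k')^-1; nra.
elim: k => [_|k ih kn].
  have P0 : modC (perturbation z 0 - 1) <= 2 * 0%:R * mu.
    by rewrite /= subrr modC0 mulr0 mul0r.
  by split => //; exact: orb.
have [P1 [q1 q2]] := ih (ltnW kn).
have pm : modC (p (orbit_pt z k)) <= mu.
  rewrite (surjective_pairing (orbit_pt z k)); apply: p_small => //; lra.
have P2 : modC (perturbation z k.+1 - 1) <= 2 * k.+1%:R * mu.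
  rewrite perturbationS.
  rewrite (_ : _ - 1 = (perturbation z k - 1) * (1 + p (orbit_pt z k)) + p (orbit_pt z k)); last by ring.
  apply: (le_trans (modCD _ _)); rewrite modCM -[k.+1%:R]natr1.
  have h1 : modC (1 + p (orbit_pt z k)) <= 1 + mu.
    by apply: (le_trans (modCD _ _)); rewrite modC1 lerD2l.
  have := ler_pM (modC_ge0 _) (modC_ge0 _) P1 h1; have := kmu _ (ltnW kn).
  set K := 2 * k%:R * mu => K4.
  (* The step adds at most [K * mu + mu], and [K <= 1/4] keeps this below [2 * mu]: hence the factor
     2 in the bound. *)
  have -> : 2 * (k%:R + 1) * mu = K + 2 * mu by rewrite /K; ring.
  nra.
by split => //; exact: orb.
Qed.

Lemma orbit_p_small n b z k : 0 <= Cp -> (0 < n)%N -> admissible n b -> bounded_by b z -> (k < n)%N ->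
  modC (p (orbit_pt z k)) <= 2^-1.
Proof.
move=> Cp0 n0 ad zb kn; have [b0 br nb nmu] := ad.
have [_ [q1 q2]] := orbit_bound Cp0 ad zb (ltnW kn).
have mu0 : 0 <= Cp * (2 * b) ^+ (2 * s).+1 by rewrite mulr_ge0// exprn_ge0// mulr_ge0// ltW.
rewrite (surjective_pairing (orbit_pt z k)).
apply: (le_trans (@p_small (2 * b) _ _ _ _ q1 q2)); [lra|lra|].
have : (1 : R) <= n%:R by rewrite ler1n.
move: nmu mu0; set mu := Cp * _; set N := n%:R; nra.
Qed.

Lemma phi_fixedP n b z (g : int) beta : 0 <= Cp -> (0 < n)%N -> admissible n b -> bounded_by b z ->
  z.1 != 0 -> n%:R * alpha = 2 * g%:~R * pi + beta ->
  fixed_iter (phi_dom r p) (phi alpha s p) n z <->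
  expC (iC R * (ofR beta + n%:R * (z.1 * z.2) ^+ s)) * perturbation z n = 1.
Proof.
move=> Cp0 n0 ad zb z1 nab; have [b0 br nb nmu] := ad.
have p0 k : (k < n)%N -> 1 + p (orbit_pt z k) != 0.
  move=> kn; have h := orbit_p_small Cp0 n0 ad zb kn.
  apply/eqP => /eqP; rewrite addr_eq0 => /eqP e; move: h.
  by rewrite -modCN -e modC1; lra.
have rot : rotation z n = expC (iC R * (ofR beta + n%:R * (z.1 * z.2) ^+ s)).
  rewrite /rotation /omega.
  have -> : n%:R * (iC R * (ofR alpha + (z.1 * z.2) ^+ s)) =
      iC R * ofR (g%:~R * (2 * pi)) + iC R * (ofR beta + n%:R * (z.1 * z.2) ^+ s).
    rewrite -mulrDr addrA -ofRD.
    have -> : g%:~R * (2 * pi) + beta = n%:R * alpha by rewrite nab; ring.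
    by rewrite ofRM ofR_nat; ring.
  by rewrite expCD expC_2pi mul1r.
rewrite -rot; split=> [[_]|e].
  rewrite iter_phi// => /(congr1 fst) /= e; apply: (mulIf z1).
  by rewrite mul1r.
split=> [k kn|]; last by rewrite iter_phi// /orbit_pt e mul1r invr1 mulr1 -surjective_pairing.
rewrite iter_phi; last by move=> j jk; apply: p0; exact: ltn_trans jk kn.
split; last exact: p0.
have [_ [q1 q2]] := orbit_bound Cp0 ad zb (ltnW kn).
by split; [apply: le_lt_trans q1 _|apply: le_lt_trans q2 _]; lra.
Qed.

Lemma upoly_perturbation n b rho X Y k : 0 <= Cp -> admissible n b -> (k <= n)%N ->
  upoly rho X -> upoly rho Y -> (forall w, modC w <= rho -> bounded_by b (X w, Y w)) ->
  upoly rho (fun w => perturbation (X w, Y w) k).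
Proof.
move=> Cp0 ad + XP YP XYb; have [b0 br nb nmu] := ad.
have omP : upoly rho (fun w => iC R * omega alpha s (X w * Y w)).
  apply: upolyM; first exact: upoly_cst.
  by apply: upolyD; [exact: upoly_cst|apply/upolyX/upolyM].
have rotP j : upoly rho (fun w => rotation (X w, Y w) j).
  by apply: upoly_exp; apply: upolyM => //; exact: upoly_cst.
have rotIP j : upoly rho (fun w => (rotation (X w, Y w) j)^-1).
  apply: eq_upoly (fun w _ => expCN _) _ => /=.
  by apply/upoly_exp/upolyN; apply: upolyM => //; exact: upoly_cst.
elim: k => [_|k ih kn]; first exact: upoly_cst.
have {}ih := ih (ltnW kn).
apply: upolyM => //; apply: upolyD; first exact: upoly_cst.
apply: (@p_upoly (2 * b)); first lra.
- by apply: upolyM => //; exact: upolyM.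
- apply: upolyM => //; apply: eq_upoly (fun w _ => esym (invfM _ _)) _ => /=.
  apply: upolyM => //; apply: upoly_inv => // w wr.
  have [h _] := orbit_bound Cp0 ad (XYb w wr) (ltnW kn); apply: (le_trans h).
  have mu0 : 0 <= Cp * (2 * b) ^+ (2 * s).+1 by rewrite mulr_ge0// exprn_ge0// mulr_ge0// ltW.
  apply: (@le_trans _ _ 4^-1); last lra.
  by apply: le_trans nmu; rewrite ler_wpM2r// ler_wpM2l// ler_nat ltnW.
- by move=> w wr; have [_] := orbit_bound Cp0 ad (XYb w wr) (ltnW kn).
Qed.

(** * The fixed-point equation and its simplified Newton map *)

Definition defect (B : R) n z : C :=
  expC (iC R * (ofR (- B) + n%:R * (z.1 * z.2) ^+ s)) * perturbation z n - 1.

(* With [k1 + k2 = 2] the product of the coordinates is [x y exp (2 t)] in all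
   cases; [(1, 1)] freezes their quotient, [(2, 0)] freezes the second one. *)
Definition lift (k1 k2 : nat) x y t : C * C :=
  (x * expC (k1%:R * t), y * expC (k2%:R * t)).

(* [(2 s) i B] is the derivative of [defect] at [t = 0] in the absence of [p]. *)
Definition newton k1 k2 (B : R) n x y t : C :=
  t - defect B n (lift k1 k2 x y t) / ((2 * s)%:R * (iC R * ofR B)).

(** Radius of the disk of the Newton map, normalized so that [|t| <= kap] gives [|2 s t| <= 1/256]
    for every [s]. *)
Definition kap : R := (32 * (16 * s%:R))^-1.

(* The last condition makes [c ^+ 2] a value of [xi eta] at the fixed points of
   the unperturbed map [p = 0]; the bounds make [newton] a contraction. *)
Definition scale n (B : R) (c : C) := [/\ (0 < n)%N, 0 < B <= (4 * 256 ^+ s)^-1,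
  128 * modC c <= r, 2 ^+ 15 * Cp * 32 ^+ (2 * s).+1 * modC c <= 1 &
  n%:R * c ^+ (2 * s) = ofR B].

(** The factor 8 leaves room for ratios slightly outside those of [Omega_set]; a lift multiplies by
    at most 2, whence the radius [16 |c|] used below. *)
Definition on_level c x y := [/\ x * y = c ^+ 2, modC x <= 8 * modC c & modC y <= 8 * modC c].

Hypothesis s_gt0 : (0 < s)%N.
Hypothesis Cp_ge0 : 0 <= Cp.

Lemma s_ge1 : 1 <= s%:R :> R.
Proof. by rewrite ler1n. Qed.

Lemma kap_gt0 : 0 < kap.
Proof. by rewrite invr_gt0 mulr_gt0 ?mulr_gt0 ?ltr0n. Qed.

Lemma kap_s : 32 * (16 * (kap * s%:R)) = 1.
Proof. by rewrite /kap; field; rewrite pnatr_eq0 -lt0n. Qed.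

Lemma kap_le : 32 * (16 * kap) <= 1.
Proof. by have := kap_s; have := s_ge1; have := kap_gt0; nra. Qed.

Opaque kap.

Lemma kap_half : kap / 2 <= kap.
Proof. by have := kap_gt0; lra. Qed.

Lemma scale_mod n B c : scale n B c -> n%:R * modC c ^+ (2 * s) = B.
Proof.
move=> [_ /andP[B0 _] _ _ /(congr1 (@modC R))].
by rewrite modCM modC_nat modCX modC_ofR (gtr0_norm B0).
Qed.

Lemma scale_le (B : R) : 0 < B <= (4 * 256 ^+ s)^-1 -> B <= 64^-1 /\ 256 ^+ s * B <= 4^-1.
Proof.
move=> /andP[B0 Bs].
have s256 : 256 <= 256 ^+ s :> R.
  by rewrite -{1}(expr1 256) ler_weXn2l// ler1n.
have p0 : 0 < 4 * 256 ^+ s :> R by rewrite mulr_gt0 ?exprn_gt0 ?ltr0n.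
have : B * (4 * 256 ^+ s) <= 1 by rewrite -(ler_pdivlMr _ _ p0) mul1r.
split; nra.
Qed.

Lemma scale_neq0 n B c : scale n B c -> c != 0.
Proof.
move=> sc; have := scale_mod sc; have [_ /andP[B0 _] _ _ _] := sc.
rewrite -modC_eq0 => e; apply/eqP => c0; move: B0.
by rewrite -e c0 expr0n muln_eq0 /= (gtn_eqF s_gt0) mulr0 ltxx.
Qed.

(** Of the [2s+1] factors [|c|], [2s] combine with [n] into [B], and the remaining one is absorbed
    by the fourth clause of [scale]. The result is small relative to [B], uniformly in [n]. *)
Lemma scale_perturbation n B c : scale n B c ->
  2 * n%:R * (Cp * (2 * (16 * modC c)) ^+ (2 * s).+1) <= B / 64 / 256.
Proof.
move=> sc; have [_ /andP[B0 _] _ cC _] := sc.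
pose D := Cp * 32 ^+ (2 * s).+1 * modC c.
have D15 : D <= (2 ^+ 15)^-1.
  by rewrite -[leRHS]mul1r ler_pdivlMr ?exprn_gt0// mulrC /D !mulrA.
have -> : 2 * n%:R * (Cp * (2 * (16 * modC c)) ^+ (2 * s).+1) =
    2 * D * (n%:R * modC c ^+ (2 * s)).
  rewrite (_ : 2 * (16 * modC c) = 32 * modC c); last by ring.
  by rewrite exprMn [modC c ^+ (2 * s).+1]exprS /D; ring.
rewrite (scale_mod sc); have -> : B / 64 / 256 = 2 * (2 ^+ 15)^-1 * B by field.
by rewrite ler_pM2r// ler_pM2l.
Qed.

(** Origin of two constants of [scale]: [8 * 16 = 128], and [n (16 |c|)^(2s) = 256^s B]. *)
Lemma scale_admissible n B c : scale n B c -> admissible n (16 * modC c).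
Proof.
move=> sc; have [n0 /scale_le[B1 B2] cr cC _] := sc; have nB := scale_mod sc.
have c0 : 0 < modC c by rewrite modC_gt0 (scale_neq0 sc).
have BB : 0 < B by case: sc => _ /andP[].
split; [lra|lra| |].
  by rewrite exprMn mulrCA nB exprM (_ : 16 ^+ 2 = 256)//; ring.
by apply: (le_trans (scale_perturbation sc)); lra.
Qed.

Lemma lift_prod k1 k2 c x y t : on_level c x y -> (k1 + k2 = 2)%N ->
  (lift k1 k2 x y t).1 * (lift k1 k2 x y t).2 = c ^+ 2 * expC (2 * t).
Proof.
move=> [xy _ _] k12; rewrite /= mulrACA xy -expCD -mulrDl -natrD k12//.
Qed.

Lemma modC_expC_kap k t : modC t <= kap -> (k <= 2)%N -> modC (expC (k%:R * t)) <= 2.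
Proof.
move=> tk k2; have h : modC (k%:R * t) <= 256^-1.
  rewrite modCM modC_nat; apply: (@le_trans _ _ (2 * kap)).
    by rewrite ler_pM ?modC_ge0// (ler_nat _ _ 2).
  by have := kap_le; lra.
have [_ h2] := @expC_sub1 R (k%:R * t) ltac:(lra).
have := modC_dist (expC (k%:R * t)) 1 0; rewrite !subr0 modC1; lra.
Qed.

Lemma lift_bounded k1 k2 c x y t : on_level c x y -> (k1 + k2 = 2)%N -> modC t <= kap ->
  bounded_by (16 * modC c) (lift k1 k2 x y t).
Proof.
move=> [_ xc yc] k12 tk.
have -> : 16 * modC c = (8 * modC c) * 2 by ring.
by split => /=; rewrite modCM; apply: ler_pM; rewrite ?modC_ge0//; apply: modC_expC_kap => //; lia.
Qed.

(** After the linear terms cancel there remain two quadratic errors of exponentials and the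
    perturbation, in all at most [4 B / (64 * 256)]. The derivative is also proportional to [B], and
    [kap_s] makes the quotient exactly [kap / 16]. *)
Lemma newton_small k1 k2 n B c x y t : scale n B c -> on_level c x y -> (k1 + k2 = 2)%N ->
  modC t <= kap -> modC (newton k1 k2 B n x y t) <= kap / 16.
Proof.
move=> sc lv k12 tk; have [n0 BB cr cC nc] := sc; have [B1 B2] := scale_le BB.
have /andP[B0 _] := BB.
have SN : s%:R != 0 :> C by rewrite pnatr_eq0 -lt0n.
have BN : ofR B != 0 :> C by rewrite -modC_eq0 modC_ofR normr_eq0 gt_eqF.
set z := lift k1 k2 x y t; set d : C := (2 * s)%:R * (iC R * ofR B).
have dE : modC d = 2 * s%:R * B.
  by rewrite /d !modCM modC_nat modC_iC mul1r modC_ofR gtr0_norm// natrM.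
have dN : d != 0 by rewrite /d mulf_neq0 ?pnatr_eq0 ?muln_eq0 ?(gtn_eqF s_gt0)// mulf_neq0// iC_neq0.
set h : C := (2 * s)%:R * t.
have hk : modC h <= 256^-1.
  rewrite /h modCM modC_nat natrM; have := kap_s; have := s_ge1; have := modC_ge0 t; nra.
set X : C := iC R * ofR B * (expC h - 1).
have xE : iC R * (ofR (- B) + n%:R * (z.1 * z.2) ^+ s) = X.
  rewrite (lift_prod _ lv k12) exprMn -exprM mulrA nc ofRN /X -expCMn.
  have -> : s%:R * (2 * t) = h by rewrite /h natrM; ring.
  by ring.
set P := perturbation z n.
(* The inner exponential is expanded at [h = 2 s t], the outer one at [X = i B (exp h - 1)]; [t * d]
   equals the common linear part [i B h]. *)
have key : newton k1 k2 B n x y t * d =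
   - ((expC h - 1 - h) * (iC R * ofR B) + (expC X - 1 - X) + expC X * (P - 1)).
  rewrite /newton -/z -/d mulrBl divfK// /defect xE -/P.
  have -> : t * d = h * (iC R * ofR B) by rewrite /d /h; ring.
  by rewrite {3}/X; ring.
have [_ h1] := @expC_sub1 R h ltac:(lra).
have h2 := @expC_quad R h ltac:(lra).
have xB : modC X <= B / 128.
  rewrite /X !modCM modC_iC mul1r modC_ofR (gtr0_norm B0) ler_pM2l//; lra.
have x2 := @expC_quad R X ltac:(lra).
have [_ x1] := @expC_sub1 R X ltac:(lra).
have eX : modC (expC X) <= 2.
  have := modC_dist (expC X) 1 0; rewrite !subr0 modC1; lra.
have ad := scale_admissible sc.
have [P1 _] := orbit_bound Cp_ge0 ad (lift_bounded lv k12 tk) (leqnn n).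
have {}P1 : modC (P - 1) <= B / 64 / 256.
  exact: (le_trans P1 (scale_perturbation sc)).
have e1 : modC ((expC h - 1 - h) * (iC R * ofR B)) <= B / 64 / 256.
  have -> : B / 64 / 256 = B * (64^-1 / 256) by rewrite mulrA.
  rewrite !modCM modC_iC mul1r modC_ofR (gtr0_norm B0) mulrC (ler_pM2l B0).
  by apply: (le_trans h2); rewrite expr2; have := modC_ge0 h; nra.
have e2 : modC (expC X - 1 - X) <= B / 64 / 256.
  by apply: (le_trans x2); rewrite expr2; have := modC_ge0 X; nra.
have e3 : modC (expC X * (P - 1)) <= 2 * (B / 64 / 256).
  by rewrite modCM ler_pM ?modC_ge0.
have : modC (newton k1 k2 B n x y t) * modC d <= kap / 16 * modC d.
  rewrite -modCM key modCN (le_trans (modCD _ _))//.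
  have -> : kap / 16 * modC d = B / 64 / 64.
    transitivity (32 * (16 * (kap * s%:R)) * (B / 64 / 64)); last by rewrite kap_s mul1r.
    by rewrite dE; field.
  have := modCD ((expC h - 1 - h) * (iC R * ofR B)) (expC X - 1 - X); lra.
by rewrite ler_pM2r// modC_gt0.
Qed.

Lemma upoly_lift k1 k2 rho (X Y T : C -> C) :
  upoly rho X -> upoly rho Y -> upoly rho T ->
  upoly rho (fun w => (lift k1 k2 (X w) (Y w) (T w)).1) /\
  upoly rho (fun w => (lift k1 k2 (X w) (Y w) (T w)).2).
Proof.
by move=> XP YP TP; split => /=; apply: upolyM => //; apply: upoly_exp;
  apply: upolyM => //; exact: upoly_cst.
Qed.

Lemma upoly_newton k1 k2 n B c rho X Y T : scale n B c -> (k1 + k2 = 2)%N ->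
  upoly rho X -> upoly rho Y -> upoly rho T ->
  (forall w, modC w <= rho -> on_level c (X w) (Y w)) ->
  (forall w, modC w <= rho -> modC (T w) <= kap) ->
  upoly rho (fun w => newton k1 k2 B n (X w) (Y w) (T w)).
Proof.
move=> sc k12 XP YP TP lv Tk; have ad := scale_admissible sc.
have [L1 L2] := upoly_lift k1 k2 XP YP TP.
apply: upolyD => //; apply: upolyN; apply: upolyM; last exact: upoly_cst.
apply: upolyD; last exact: upoly_cst.
apply: upolyM.
  apply: upoly_exp; apply: upolyM; first exact: upoly_cst.
  apply: upolyD; first exact: upoly_cst.
  by apply: upolyM; [exact: upoly_cst|apply/upolyX/upolyM].
apply: (upoly_perturbation Cp_ge0 ad (leqnn n) L1 L2) => w wr.
exact: (lift_bounded (lv w wr) k12 (Tk w wr)).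
Qed.

(** For [|t - u| > kap / 4] the bound [kap / 16] on both values is enough. Otherwise the Schwarz
    lemma on the disk of radius [kap / 2] about [u] gives the Lipschitz constant 1/4. *)
Lemma newton_lip k1 k2 n B c x y t u : scale n B c -> on_level c x y -> (k1 + k2 = 2)%N ->
  modC t <= kap / 2 -> modC u <= kap / 2 ->
  modC (newton k1 k2 B n x y t - newton k1 k2 B n x y u) <= 2^-1 * modC (t - u).
Proof.
move=> sc lv k12 tk uk; have k0 := kap_gt0; have k20 : 0 < kap / 2 by rewrite divr_gt0.
have disk w : modC w <= kap / 2 -> modC (u + w) <= kap.
  by move=> wk; rewrite (le_trans (modCD _ _))//; lra.
have [tu|tu] := leP (modC (t - u)) (kap / 4); last first.
  apply: (le_trans (modCB _ _)).
  have h1 := newton_small sc lv k12 (le_trans tk kap_half).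
  have h2 := newton_small sc lv k12 (le_trans uk kap_half).
  apply: (le_trans (lerD h1 h2)); apply: (@le_trans _ _ (2^-1 * (kap / 4))).
    by rewrite -subr_ge0 (_ : _ - _ = 0); [|field].
  by rewrite ler_pM2l ?invr_gt0// ltW.
have uP : upoly (kap / 2) (fun w => newton k1 k2 B n x y (u + w)).
  apply: (upoly_newton sc k12 (X := fun=> x) (Y := fun=> y) (T := fun w => u + w)) => //.
  - exact: upoly_cst.
  - exact: upoly_cst.
  - by apply: upolyD; [exact: upoly_cst|exact: upoly_id].
have uM w : modC w <= kap / 2 -> modC (newton k1 k2 B n x y (u + w)) <= kap / 16.
  by move=> wk; apply: (newton_small sc lv k12); exact: disk.
have rel : modC (t - u) <= (modC (t - u) / (kap / 2)) * (kap / 2) by rewrite divfK// gt_eqF.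
have th : 0 <= modC (t - u) / (kap / 2) <= 2^-1.
  apply/andP; split; first by rewrite divr_ge0 ?modC_ge0// ltW.
  by rewrite ler_pdivrMr//; lra.
have := upoly_schwarz k20 uP uM th rel.
rewrite addr0 (addrC u) subrK => h; apply: (le_trans h).
rewrite (_ : 2 * _ * _ = 4^-1 * modC (t - u)); last by field; rewrite gt_eqF.
by rewrite ler_wpM2r ?modC_ge0//; lra.
Qed.

Lemma newton_defect k1 k2 n B c x y t : scale n B c ->
  newton k1 k2 B n x y t = t <-> defect B n (lift k1 k2 x y t) = 0.
Proof.
move=> [n0 /andP[B0 _] _ _ _].
have dN : ((2 * s)%:R * (iC R * ofR B) : C) != 0.
  rewrite mulf_neq0 ?pnatr_eq0 ?muln_eq0 ?(gtn_eqF s_gt0)// mulf_neq0 ?iC_neq0//.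
  by rewrite -modC_eq0 modC_ofR normr_eq0 gt_eqF.
rewrite /newton; split => [/eqP|->]; last by rewrite mul0r subr0.
rewrite -subr_eq0 addrAC subrr add0r oppr_eq0 mulf_eq0 invr_eq0 (negbTE dN) orbF.
by move/eqP.
Qed.

Lemma solve_defect k1 k2 n B c : scale n B c -> (k1 + k2 = 2)%N ->
  exists sol : C -> C -> C,
    (forall x y, on_level c x y -> [/\ modC (sol x y) <= kap / 2,
        defect B n (lift k1 k2 x y (sol x y)) = 0 &
        forall t, modC t <= kap / 2 -> defect B n (lift k1 k2 x y t) = 0 -> t = sol x y]) /\
    (forall rho X Y, upoly rho X -> upoly rho Y ->
      (forall w, modC w <= rho -> on_level c (X w) (Y w)) ->
      upoly rho (fun w => sol (X w) (Y w))).
Proof.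
move=> sc k12; have k0 := kap_gt0; pose k := kap / 2.
have k20 : 0 <= k by rewrite divr_ge0// ltW.
have stab x y : on_level c x y -> forall t, modC t <= k -> modC (newton k1 k2 B n x y t) <= k.
  move=> lv t tk; have := newton_small sc lv k12 (t := t); rewrite /k in tk *; lra.
have lip x y : on_level c x y -> forall t u, modC t <= k -> modC u <= k ->
    modC (newton k1 k2 B n x y t - newton k1 k2 B n x y u) <= 2^-1 * modC (t - u).
  by move=> lv t u tk uk; exact: (newton_lip sc lv k12 tk uk).
have ex (q : C * C) : exists t : C, on_level c q.1 q.2 -> [/\ modC t <= k,
    newton k1 k2 B n q.1 q.2 t = t &
    forall m, modC (iter m (newton k1 k2 B n q.1 q.2) 0 - t) <= 4 * k * 2^-1 ^+ m].
  (* Off the level set the solution takes the irrelevant value 0, so that one choice defines it for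
     all pairs. *)
  have [lv|nlv] := pselect (on_level c q.1 q.2); last by exists 0.
  by have [t tP] := contraction_fixpoint (stab _ _ lv) (lip _ _ lv) k20; exists t.
have [sol solP] := choice ex; exists (fun x y => sol (x, y)); split.
  move=> x y lv; have [s1 s2 _] := solP (x, y) lv; split => //.
    by apply/(newton_defect k1 k2 x y _ sc).
  move=> t tk /(newton_defect k1 k2 x y _ sc) tf.
  exact: (contraction_unique (lip _ _ lv)).
move=> rho X Y XP YP lv; apply: upoly_lim => e e0.
have [m mP] := geo_half_ev (4 * k) e0.
have itP j : upoly rho (fun w => iter j (newton k1 k2 B n (X w) (Y w)) 0) /\
    forall w, modC w <= rho -> modC (iter j (newton k1 k2 B n (X w) (Y w)) 0) <= k.
  elim: j => [|j [ih1 ih2]].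
    by split=> [|w wr]; [exact: upoly_cst|rewrite modC0].
  split=> [|w wr]; last by rewrite iterS; apply: (stab _ _ (lv w wr)); exact: ih2.
  apply: (upoly_newton sc k12 XP YP ih1 lv) => w wr.
  by apply: (le_trans (ih2 w wr)); rewrite /k; lra.
exists (fun w => iter m (newton k1 k2 B n (X w) (Y w)) 0); first exact: (itP m).1.
move=> w wr; have [_ _ h] := solP (X w, Y w) (lv w wr).
by rewrite modCBC; apply: (le_trans (h m)); exact: mP.
Qed.

(** * Localization of the fixed points near those of the unperturbed map *)

Definition local_constant : R := 8 * Cp * 2 ^+ (2 * s).+1 * 4 ^+ s.

(** The last clause bounds the relative error [local_constant * eps] of [n t^s] against [B] by
    1/1024; its logarithm is then at most [1/512 = kap * s], and division by [2 s] gives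
    [kap / 2]. *)
Definition eps_small (eps : R) :=
  [/\ 0 < eps <= 4^-1, 8 * eps <= r & 32 * (32 * (local_constant * eps)) <= 1].

Lemma s2_gt0 : (0 < 2 * s)%N.
Proof. by rewrite muln_gt0. Qed.

Lemma exp2s_le (x : R) : 0 <= x <= 1 -> x ^+ (2 * s) <= x ^+ 2.
Proof.
move=> /andP[x0 x1]; rewrite exprM -[leRHS]expr1.
by apply: ler_wiXn2l; rewrite ?exprn_ge0 ?exprn_ile1.
Qed.

Lemma local_bound n (b eps : R) : eps_small eps -> (0 < n)%N -> 0 < b ->
  n%:R * b ^+ (2 * s) <= eps ^+ (2 * s) -> b <= eps.
Proof.
move=> [/andP[e0 _] _ _] n0 b0 nb.
rewrite -(@ler_pXn2r _ (2 * s)) ?s2_gt0 ?nnegrE ?(ltW b0) ?(ltW e0)//; apply: le_trans nb.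
by rewrite ler_peMl ?exprn_ge0 ?ler1n// ltW.
Qed.

Lemma local_perturbation n (b eps : R) : eps_small eps -> (0 < n)%N -> 0 < b ->
  n%:R * b ^+ (2 * s) <= eps ^+ (2 * s) ->
  2 * n%:R * (Cp * (2 * b) ^+ (2 * s).+1) <=
  2 * Cp * 2 ^+ (2 * s).+1 * eps * (n%:R * b ^+ (2 * s)).
Proof.
move=> ep n0 b0 nb; have be := local_bound ep n0 b0 nb.
have -> : 2 * n%:R * (Cp * (2 * b) ^+ (2 * s).+1) =
    2 * Cp * 2 ^+ (2 * s).+1 * b * (n%:R * b ^+ (2 * s)).
  by rewrite exprMn [b ^+ (2 * s).+1]exprS; ring.
rewrite ler_wpM2r ?mulr_ge0 ?exprn_ge0 ?(ltW b0)// ler_wpM2l//.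
by rewrite !mulr_ge0 ?exprn_ge0.
Qed.

Lemma local_admissible n (b eps : R) : eps_small eps -> (0 < n)%N -> 0 < b ->
  n%:R * b ^+ (2 * s) <= eps ^+ (2 * s) -> admissible n b.
Proof.
move=> ep n0 b0 nb; have be := local_bound ep n0 b0 nb.
have lp := local_perturbation ep n0 b0 nb.
have [/andP[e0 e4] er eK] := ep.
have e2 : eps ^+ (2 * s) <= eps ^+ 2 by apply: exp2s_le; apply/andP; split; lra.
have nb16 : n%:R * b ^+ (2 * s) <= 16^-1 by apply: (le_trans nb); rewrite expr2 in e2; nra.
split => //; [lra|lra|].
apply: (le_trans lp).
have s4 : 1 <= 4 ^+ s :> R by rewrite exprn_ege1// ler1n.
set D := Cp * 2 ^+ (2 * s).+1 * eps.
have D0 : 0 <= D by rewrite !mulr_ge0 ?exprn_ge0// ltW.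
have D1 : 8 * D <= 1.
  have : local_constant * eps = 8 * D * 4 ^+ s by rewrite /D /local_constant; ring.
  move: eK => /[swap] -> {lp}; move: (4 ^+ s) s4 => S S1 h.
  by have := mulr_ge0 D0 (ltac:(lra) : 0 <= S - 1); nra.
have -> : 2 * Cp * 2 ^+ (2 * s).+1 * eps = 2 * D by rewrite /D; ring.
have := exprn_ge0 (2 * s) (ltW b0); set u := b ^+ _ in nb16 *; have := ler0n R n.
by move=> nn u0; have := mulr_ge0 nn u0; nra.
Qed.

(** Comparability of [b^2] with [|z.1 z.2|] makes the perturbation [O(eps)] relative to
    [n (z.1 z.2)^s]. Inverting [expC] near 0 transfers this to the exponent, and a small logarithm
    of the ratio to [B] yields [t]. *)
Lemma localization n B z (b eps : R) : eps_small eps -> (0 < n)%N -> 0 < B <= 16^-1 -> 0 < b ->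
  n%:R * b ^+ (2 * s) <= eps ^+ (2 * s) -> bounded_by b z -> b ^+ 2 <= 4 * modC (z.1 * z.2) ->
  defect B n z = 0 ->
  exists2 t : C, modC t <= kap / 2 &
    n%:R * (z.1 * z.2) ^+ s = ofR B * expC ((2 * s)%:R * t).
Proof.
move=> ep n0 /andP[B0 B16] b0 nb zb bt dz.
have ad := local_admissible ep n0 b0 nb.
have [P1 _] := orbit_bound Cp_ge0 ad zb (leqnn n).
have {}P1 := le_trans P1 (local_perturbation ep n0 b0 nb).
have [/andP[e0 e4] er eK] := ep.
have e2 : eps ^+ (2 * s) <= eps ^+ 2 by apply: exp2s_le; apply/andP; split; lra.
have nb16 : n%:R * b ^+ (2 * s) <= 16^-1 by apply: (le_trans nb); rewrite expr2 in e2; nra.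
set t := z.1 * z.2 in bt *.
have t0 : 0 < modC t by have := exprn_gt0 2 b0; lra.
have tN : t != 0 by rewrite -modC_gt0.
have nR : 0 < n%:R :> R by rewrite ltr0n.
pose T1 := n%:R * modC t ^+ s.
have T0 : 0 < T1 by rewrite mulr_gt0// exprn_gt0.
have tb : modC t <= b ^+ 2.
  by case: zb => z1 z2; rewrite modCM expr2 ler_pM ?modC_ge0.
have T16 : T1 <= 16^-1.
  apply: le_trans nb16; rewrite ler_pM2l// exprM lerXn2r// nnegrE ?modC_ge0// exprn_ge0// ltW//.
have bT : n%:R * b ^+ (2 * s) <= 4 ^+ s * T1.
  rewrite /T1 mulrCA -exprMn ler_pM2l// exprM lerXn2r// nnegrE ?exprn_ge0 ?mulr_ge0 ?modC_ge0// ltW//.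
set X : C := iC R * (ofR (- B) + n%:R * t ^+ s).
have nT : modC (n%:R * t ^+ s : C) = T1 by rewrite modCM modC_nat modCX.
have XE : modC X = modC (ofR B - n%:R * t ^+ s).
  by rewrite /X modCM modC_iC mul1r ofRN -[in RHS]modCN opprB addrC.
(* Both [B] and [n |t|^s] are at most 1/16, so no nonzero multiple of [2 pi i] can occur in the
   exponent. *)
have X8 : modC X <= 8^-1.
  rewrite XE; apply: (le_trans (modCB _ _)); rewrite nT modC_ofR gtr0_norm//; lra.
have [x1 x2] := expC_sub1 X8.
have eX : modC (expC X) <= 2.
  by have := modC_dist (expC X) 1 0; rewrite !subr0 modC1; lra.
have dX : expC X - 1 = - (expC X * (perturbation z n - 1)).
  move: dz; rewrite /defect -/t -/X => /eqP; rewrite subr_eq0 => /eqP h.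
  by rewrite mulrBr mulr1 h opprB.
(* Origin of [local_constant]: a factor 2 for inverting [expC - 1], 2 for [|expC X|],
   [2 Cp 2^(2s+1)] from the perturbation, and [4^s] from [b^2 <= 4 |t|]. *)
have {}x1 : modC X <= local_constant * eps * T1.
  apply: (le_trans x1); rewrite dX modCN modCM.
  apply: (@le_trans _ _ (2 * (2 * modC (perturbation z n - 1)))).
    by rewrite ler_pM2l// ler_wpM2r ?modC_ge0.
  rewrite mulrA; apply: (@le_trans _ _ (2 * 2 * (2 * Cp * 2 ^+ (2 * s).+1 * eps * (4 ^+ s * T1)))).
    rewrite ler_pM2l ?mulr_gt0//; apply: (le_trans P1); rewrite ler_wpM2l//.
    by rewrite !mulr_ge0 ?exprn_ge0// ltW.
  by rewrite /local_constant le_eqVlt; apply/orP; left; apply/eqP; ring.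
(* The error is measured against [n |t|^s], hence this quotient rather than its inverse; the sign of
   the logarithm is changed below. *)
set y : C := ofR B / (n%:R * t ^+ s).
have ntN : n%:R * t ^+ s != 0 :> C by rewrite mulf_neq0 ?expf_neq0// pnatr_eq0 -lt0n.
have BN : ofR B != 0 :> C by rewrite -modC_eq0 modC_ofR normr_eq0 gt_eqF.
have y1 : modC (y - 1) <= local_constant * eps.
  have -> : y - 1 = (ofR B - n%:R * t ^+ s) / (n%:R * t ^+ s) by rewrite mulrBl divff.
  by rewrite modCM modCV nT -XE ler_pdivrMr.
have [|w wy wk] := @local_log R y; first by apply: (le_trans y1); lra.
have sC : (2 * s)%:R != 0 :> C by rewrite pnatr_eq0 -lt0n s2_gt0.
exists (- w / (2 * s)%:R); last first.
  have -> : (2 * s)%:R * (- w / (2 * s)%:R) = - w by rewrite mulrCA divff// mulr1.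
  by rewrite expCN wy /y invf_div mulrCA divff// mulr1.
have k0 := kap_gt0; have ks := kap_s; have s1 := s_ge1.
rewrite modCM modCN modCV modC_nat ler_pdivrMr ?ltr0n ?s2_gt0// natrM.
have -> : kap / 2 * (2 * s%:R) = kap * s%:R by field.
apply: (le_trans wk); lra.
Qed.

(** * The branches and their separation *)

Definition branch (c0 : R) (j : nat) : C := ofR c0 * expC (iC R * ofR (pi * j%:R / s%:R)).

Lemma modC_branch c0 j : 0 < c0 -> modC (branch c0 j) = c0.
Proof. by move=> c00; rewrite modCM modC_ofR modC_expC_i mulr1 gtr0_norm. Qed.

Lemma branch_sqr c0 j : branch c0 j ^+ 2 = ofR (c0 ^+ 2) * expC (iC R * ofR (2 * pi * j%:R / s%:R)).
Proof.
rewrite exprMn ofRX -expCMn -(@ofR_nat R 2) mulrCA -ofRM.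
by congr (_ * expC (_ * ofR _)); ring.
Qed.

Lemma branch_exp2s c0 j : branch c0 j ^+ (2 * s) = ofR (c0 ^+ (2 * s)).
Proof.
have sR : s%:R != 0 :> R by rewrite pnatr_eq0 -lt0n.
rewrite exprM branch_sqr exprMn -ofRX -exprM -expCMn -(@ofR_nat R s) mulrCA -ofRM.
rewrite (_ : s%:R * _ = (Posz j)%:~R * (2 * pi)); last by rewrite -pmulrn; field.
by rewrite expC_2pi mulr1.
Qed.

Lemma branch_exists n (B c0 : R) (t u : C) : (0 < n)%N -> 0 < c0 -> n%:R * c0 ^+ (2 * s) = B ->
  n%:R * t ^+ s = ofR B * expC ((2 * s)%:R * u) ->
  exists2 j : nat, (j < s)%N & t = branch c0 j ^+ 2 * expC (2 * u).
Proof.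
move=> n0 c00 nB ts; have nC : n%:R != 0 :> C by rewrite pnatr_eq0 -lt0n.
have cN : ofR (c0 ^+ 2) != 0 :> C.
  by rewrite -modC_eq0 modC_ofR normr_eq0 expf_neq0// gt_eqF.
have eN := expC_neq0 (2 * u).
have {}ts : (t / (ofR (c0 ^+ 2) * expC (2 * u))) ^+ s = 1.
  have {}ts : t ^+ s = (ofR (c0 ^+ 2) * expC (2 * u)) ^+ s.
    apply: (mulfI nC); rewrite ts -nB ofRM ofR_nat exprMn -mulrA; congr (_ * (_ * _)).
      by rewrite -ofRX -exprM.
    by rewrite -expCMn natrM; congr expC; ring.
  by rewrite exprMn exprVn ts divff// expf_neq0// mulf_neq0.
have [j js jE] := unity_root_exp s_gt0 ts; exists j => //.
by rewrite branch_sqr -jE; field; rewrite eN cN.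
Qed.

(** Multiplied by [s / (2 pi)], the equation makes the integer [j - k s] equal to [- x s / pi],
    whose modulus is less than 1; then [0 <= j < s] forces [j = 0]. This separates the branches and
    also selects the real one. *)
Lemma branch_angle (j : nat) (k : int) (x : R) : (j < s)%N -> `|x| <= kap ->
  2 * pi * j%:R / s%:R + 2 * x = k%:~R * (2 * pi) -> j = 0%N.
Proof.
move=> js xk e; have pi2 := pi_ge2 R; have sR : 0 < s%:R :> R by rewrite ltr0n.
have e2 : (j%:R - k%:~R * s%:R) * pi = - x * s%:R.
  have : (2 * pi * j%:R / s%:R + 2 * x) * s%:R = k%:~R * (2 * pi) * s%:R by rewrite e.
  rewrite mulrDl divfK ?gt_eqF// => h; lra.
have e3 : `|j%:R - k%:~R * s%:R| < 1 :> R.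
  have h : `|j%:R - k%:~R * s%:R| * pi = `|x| * s%:R.
    by rewrite -(gtr0_norm (pi_gt0 R)) -normrM e2 normrM normrN (gtr0_norm sR).
  have ks := kap_s; have : `|x| * s%:R <= kap * s%:R by rewrite ler_pM2r.
  rewrite -h; move: (normr_ge0 (j%:R - k%:~R * s%:R : R)); set a := `|_| => a0 ha; nra.
have e4 : (`|j%:Z - k * s%:Z| < 1)%R.
  by rewrite -(ltr_int R) intr_norm intrB intrM -!pmulrn.
have : k = 0 by nia.
lia.
Qed.

Lemma branch_uniq (c0 : R) i j (t u : C) : 0 < c0 -> (i < s)%N -> (j < s)%N ->
  modC t <= kap / 2 -> modC u <= kap / 2 ->
  branch c0 i ^+ 2 * expC (2 * t) = branch c0 j ^+ 2 * expC (2 * u) -> i = j.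
Proof.
move=> c00; wlog ij : i j t u / (j <= i)%N => [W|] si sj tk uk e.
  by have [ji|/ltnW ij] := leqP j i; [exact: W e|apply/esym; exact: W (esym e)].
suff : (i - j)%N = 0%N by lia.
have cN : ofR (c0 ^+ 2) != 0 :> C.
  by rewrite -modC_eq0 modC_ofR normr_eq0 expf_neq0// gt_eqF.
move: e; rewrite !branch_sqr -!(mulrA (ofR (c0 ^+ 2))) => /(mulfI cN); rewrite -!expCD => e.
have {}e : expC (iC R * ofR (2 * pi * (i - j)%:R / s%:R) + 2 * (t - u)) = 1.
  rewrite natrB// mulrBr mulrBl ofRD ofRN mulrBr.
  set A := iC R * ofR (2 * pi * i%:R / s%:R) in e *; set A' := iC R * ofR _ in e *.
  have -> : A - A' + 2 * (t - u) = (A + 2 * t) - (A' + 2 * u) by ring.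
  by rewrite expCB e divff ?expC_neq0.
have [k kE] := expC_eq1 e.
apply: (@branch_angle (i - j) k (imC (t - u))); first by lia.
  apply: (le_trans (im_le_modC _)); apply: (le_trans (modCB _ _)).
  by rewrite (splitr kap) lerD.
have := congr1 (@imC R) kE; rewrite (imCD (iC R * ofR _)) !imC_iM.
suff -> : imC (2 * (t - u)) = 2 * imC (t - u) by [].
by rewrite -(@ofR_nat R 2) imCM /= -/(imC (t - u)); ring.
Qed.

Lemma root_n n : (0 < n)%N ->
  0 < (n%:R : R) `^ (- (2 * s)%:R^-1) /\
  n%:R * ((n%:R : R) `^ (- (2 * s)%:R^-1)) ^+ (2 * s) = 1.
Proof.
move=> n0; have nR : 0 < n%:R :> R by rewrite ltr0n.
split; first exact: powR_gt0.
rewrite -powR_mulrn ?powR_ge0// -powRrM mulNr mulVf ?pnatr_eq0 -?lt0n ?s2_gt0//.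
by rewrite powR_inv1 ?ltW// divff// gt_eqF.
Qed.

Lemma Omega_bound n (eps : R) z : (0 < n)%N -> 0 < eps -> Omega_set s n eps z ->
  [/\ z.1 != 0, z.2 != 0 & exists b : R, [/\ 0 < b, n%:R * b ^+ (2 * s) <= eps ^+ (2 * s),
   bounded_by b z & b ^+ 2 <= 4 * modC (z.1 * z.2)]].
Proof.
move=> n0 e0 [/andP[z1 z1b] [/andP[z2 z2b] /andP[q1 q2]]].
have [N0 NE] := root_n n0; set N1 := _ `^ _ in N0 NE z1b z2b.
(* The actual size of the point, not the radius of [Omega_set]: only the former is comparable with
   the product of the coordinates. *)
rewrite -!modC_gt0; split => //; exists (Num.max (modC z.1) (modC z.2)).
have bN : Num.max (modC z.1) (modC z.2) < eps * N1 by rewrite gt_max z1b z2b.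
split; first by rewrite lt_max z1.
- have -> : eps ^+ (2 * s) = n%:R * (eps * N1) ^+ (2 * s) by rewrite exprMn mulrCA NE mulr1.
  rewrite ler_wpM2l// lerXn2r ?nnegrE ?le_max ?modC_ge0 ?mulr_ge0 ?(ltW e0) ?(ltW N0)//.
  exact: ltW.
- by split; rewrite le_max lexx ?orbT.
rewrite modCM; move: q1 q2; rewrite modCM modCV ltr_pdivrMr// ltr_pdivlMr// => q1 q2.
by case: (leP (modC z.1) (modC z.2)) => _; nra.
Qed.

(** * The fixed-point curves *)

Section Curves.
Variables (n : nat) (B c0 eps : R) (g : int).
Hypothesis n_gt0 : (0 < n)%N.
Hypothesis B_small : 0 < B <= 16^-1.
Hypothesis c0_gt0 : 0 < c0.
Hypothesis nc0 : n%:R * c0 ^+ (2 * s) = B.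
Hypothesis branch_scale : forall j, scale n B (branch c0 j).
Hypothesis eps_ok : eps_small eps.
(** A point of a curve has coordinates of modulus at most [c0 * 2 * 2], one factor from the ratio
    and one from the height; the size condition of [Omega_set] thus never cuts the curve. *)
Hypothesis c0_eps : 4 * c0 < eps * (n%:R : R) `^ (- (2 * s)%:R^-1).
Hypothesis n_alpha : n%:R * alpha = 2 * g%:~R * pi + (- B).

Definition fixed_set := fixed_iter (phi_dom r p) (phi alpha s p) n.

Definition curve j : set (C * C) := [set z | [/\ Omega_set s n eps z, defect B n z = 0 &
  exists2 t : C, modC t <= kap / 2 & z.1 * z.2 = branch c0 j ^+ 2 * expC (2 * t)]].

Lemma eps_gt0 : 0 < eps.
Proof. by case: eps_ok => /andP[]. Qed.

Lemma fixed_defect z : Omega_set s n eps z -> fixed_set z <-> defect B n z = 0.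
Proof.
move=> Oz; have [z1 z2 [b [b0 nb zb bt]]] := Omega_bound n_gt0 eps_gt0 Oz.
have ad := local_admissible eps_ok n_gt0 b0 nb.
have [f1 f2] := phi_fixedP Cp_ge0 n_gt0 ad zb z1 n_alpha.
by rewrite /defect; split=> [/f1 ->|/eqP]; rewrite ?subrr// subr_eq0 => /eqP.
Qed.

Lemma fixed_curves z : (fixed_set `&` Omega_set s n eps) z <-> exists j : 'I_s, curve j z.
Proof.
split=> [[fz Oz]|[j [Oz dz _]]]; last by split => //; apply/fixed_defect.
have [z1 z2 [b [b0 nb zb bt]]] := Omega_bound n_gt0 eps_gt0 Oz.
have dz := (fixed_defect Oz).1 fz.
have [t tk ts] := localization eps_ok n_gt0 B_small b0 nb zb bt dz.
have [j js jE] := branch_exists n_gt0 c0_gt0 nc0 ts.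
by exists (Ordinal js); split => //; exists t.
Qed.

Lemma curve_disjoint i j : (i < s)%N -> (j < s)%N -> i != j -> curve i `&` curve j = set0.
Proof.
move=> si sj /eqP ij; apply/seteqP; split => // z [[_ _ [t tk tE]] [_ _ [u uk uE]]].
by case: ij; apply: (branch_uniq c0_gt0 si sj tk uk); rewrite -tE.
Qed.

Lemma modC_exp_half t : modC t <= kap / 2 -> modC (expC t) <= 2 /\ 2^-1 <= modC (expC (2 * t)) <= 2.
Proof.
move=> tk; have k1 := kap_le; have k0 := kap_gt0.
have h k : (k <= 2)%N -> modC (expC (k%:R * t) - 1) <= 2^-1.
  move=> k2; have h1 : modC (k%:R * t) <= kap.
    rewrite modCM modC_nat; apply: (@le_trans _ _ (2 * (kap / 2))); last lra.
    by rewrite ler_pM ?modC_ge0// (ler_nat _ _ 2).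
  have [_ h2] := @expC_sub1 R (k%:R * t) ltac:(lra); lra.
have h1 := h 1%N isT; rewrite mul1r in h1; have {}h := h 2%N isT.
have a1 := modC_dist (expC t) 1 0; rewrite !subr0 modC1 in a1.
have a2 := modC_dist (expC (2 * t)) 1 0; rewrite !subr0 modC1 in a2.
have a3 := modC_dist 1 (expC (2 * t)) 0; rewrite !subr0 modC1 modCBC in a3.
split; first lra.
by apply/andP; split; lra.
Qed.

(** The product lies within a factor 2 of [c0^2] and the ratio within a factor 4 of 1, so [|z.2|^2]
    is between [c0^2 / 8] and [8 c0^2]. The wider annulus stated here is the one allowed by
    [on_level]. *)
Lemma curve_snd j z : curve j z -> c0 / 8 < modC z.2 < 8 * c0.
Proof.
move=> [[/andP[z1 _] [/andP[z2 _] /andP[q1 q2]]] _ [t tk tE]].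
have [_ /andP[e1 e2]] := modC_exp_half tk.
have := congr1 (@modC R) tE; rewrite [modC (_ * expC _)]modCM modCX modC_branch// modCM => m.
move: q1 q2; rewrite modCM modCV ltr_pdivrMr// ltr_pdivlMr// => q1 q2.
move: m; set x := modC z.1 in z1 q1 q2 *; set y := modC z.2 in z2 q1 q2 *.
set e := modC _ in e1 e2 * => m.
have c2 : 0 < c0 ^+ 2 by rewrite exprn_gt0.
have m1 : c0 ^+ 2 / 2 <= x * y by rewrite m; nra.
have m2 : x * y <= c0 ^+ 2 * 2 by rewrite m; nra.
apply/andP; split; rewrite -(@ltr_pXn2r _ 2) ?nnegrE ?mulr_ge0 ?divr_ge0 ?(ltW c0_gt0) ?(ltW z2)//.
  by rewrite expr_div_n; nra.
by rewrite exprMn; nra.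
Qed.

Lemma upoly_quotient (u v : C) (w0 : R) : v != 0 -> w0 <= modC v / 2 ->
  upoly w0 (fun w => u / (v + w)).
Proof.
move=> v0 w0v; have v0' : 0 < modC v by rewrite modC_gt0.
have P : upoly w0 (fun w => (1 + v^-1 * w)^-1).
  apply: upoly_inv => [|w wr].
    apply: upolyD; first exact: upoly_cst.
    by apply: upolyM; [exact: upoly_cst|exact: upoly_id].
  rewrite addrAC subrr add0r modCM modCV ler_pdivrMl//; lra.
apply: eq_upoly (upolyM (upoly_cst _ (u / v)) P) => w wr.
have vw : v + w = v * (1 + v^-1 * w) by rewrite mulrDr mulr1 mulVKf.
by rewrite vw invfM mulrA.
Qed.

(* A graph over the second coordinate, the fixed-point equation being solved for
   the first one; the whole of [Omega_set] serves as neighbourhood. *)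
Lemma curve_holomorphic j : holomorphic_curve (curve j).
Proof.
move=> z0 [Oz0 _ _]; exists (Omega_set s n eps); split; first exact: open_Omega.
split=> //; set c := branch c0 j.
have [sol [solP sol_upoly]] := solve_defect (branch_scale j) (erefl : (2 + 0 = 2)%N).
have mc : modC c = c0 by exact: modC_branch.
pose U := [set y : C | c0 / 8 < modC y < 8 * c0].
pose G (y : C) : C := c ^+ 2 / y * expC (2 * sol (c ^+ 2 / y) y).
have U0 y : U y -> y != 0.
  by move=> /andP[y1 _]; rewrite -modC_gt0; apply: lt_trans y1; rewrite divr_gt0.
have lv y : U y -> on_level c (c ^+ 2 / y) y.
  move=> Uy; have y0 := U0 _ Uy; have /andP[y1 y2] := Uy.
  split; [by rewrite divfK| |by rewrite mc ltW].
  rewrite modCM modCX modCV mc ler_pdivrMr ?modC_gt0//; move: y1; rewrite ltr_pdivrMr//; nra.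
exists U, G; split.
  split=> [|y Uy]; first exact: open_annulus.
  have y0 := U0 _ Uy; have /andP[y1 y2] := Uy.
  (* Half of each distance to 0 and to the two boundary circles, so that the disk about [y] stays in
     [U] and [c^2 / y] has a Neumann series there. *)
  pose rho := Num.min (modC y / 2) (Num.min ((modC y - c0 / 8) / 2) ((8 * c0 - modC y) / 2)).
  have rho0 : 0 < rho.
    by rewrite /rho !lt_min !divr_gt0 ?modC_gt0 ?subr_gt0.
  have Uw w : modC w <= rho -> U (y + w).
    rewrite /rho !le_min => /andP[_ /andP[w1 w2]].
    have h1 := modCD y w; have h2 := modCB (y + w) w; rewrite addrK in h2.
    by apply/andP; split; lra.
  apply: (@upoly_derivable R G y rho rho0).
  have P1 : upoly rho (fun w => c ^+ 2 / (y + w)).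
    by apply: upoly_quotient => //; rewrite /rho ge_min lexx.
  have P2 : upoly rho (fun w => y + w) by apply: upolyD; [exact: upoly_cst|exact: upoly_id].
  apply: upolyM => //; apply: upoly_exp; apply: upolyM; first exact: upoly_cst.
  by apply: sol_upoly => // w wr; exact: lv (Uw w wr).
right=> z; split.
  move=> [cz Oz]; have Uz := curve_snd cz; split => //; split => //.
  have [_ dz [t tk tE]] := cz; have z20 := U0 _ Uz.
  have z1E : z.1 = c ^+ 2 / z.2 * expC (2 * t).
    by apply: (mulIf z20); rewrite tE -/c [RHS]mulrAC divfK.
  have [_ _ uniq] := solP _ _ (lv _ Uz).
  rewrite /G -(uniq t tk)//.
  have -> : lift 2 0 (c ^+ 2 / z.2) z.2 t = z.
    by rewrite /lift -z1E mul0r expC0 mulr1 -surjective_pairing.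
  exact: dz.
move=> [Oz [Uz zE]]; split => //; have z20 := U0 _ Uz.
have [sk sd _] := solP _ _ (lv _ Uz); split => //.
  move: sd; have -> // : lift 2 0 (c ^+ 2 / z.2) z.2 (sol (c ^+ 2 / z.2) z.2) = z.
  by rewrite /lift -/(G z.2) -zE mul0r expC0 mulr1 -surjective_pairing.
exists (sol (c ^+ 2 / z.2) z.2) => //.
by rewrite zE /G mulrAC divfK.
Qed.

(** * Parametrization of a curve by half the logarithm of the coordinate ratio *)

Section Parametrization.
Variables (j : nat) (sol : C -> C -> C).
Local Notation c := (branch c0 j).
Hypothesis solP : forall x y, on_level c x y -> [/\ modC (sol x y) <= kap / 2,
  defect B n (lift 1 1 x y (sol x y)) = 0 &
  forall t, modC t <= kap / 2 -> defect B n (lift 1 1 x y t) = 0 -> t = sol x y].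
Hypothesis sol_upoly : forall rho X Y, upoly rho X -> upoly rho Y ->
  (forall w, modC w <= rho -> on_level c (X w) (Y w)) -> upoly rho (fun w => sol (X w) (Y w)).

Definition height (v : C) : C := sol (c * expC v) (c * expC (- v)).

Definition param (v : C) : C * C := lift 1 1 (c * expC v) (c * expC (- v)) (height v).

(** The margin 1/4 beyond [ln 2] leaves a disk of that radius about every point of the strip on
    which the solution is still defined. *)
Lemma strip_level v : `|reC v| <= ln 2 + 4^-1 -> on_level c (c * expC v) (c * expC (- v)).
Proof.
move=> vr; have h (u : R) : u <= ln 2 + 4^-1 -> expR u <= 8.
  move=> xl; apply: (@le_trans _ _ (2 * (4 / 3))); last lra.
  rewrite -{1}(@lnK R 2) ?posrE// -(subrK (ln 2) u) addrC expRD ler_pM2l ?expR_gt0//.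
  by apply: expR_quarter; lra.
move: vr; rewrite ler_norml => /andP[v1 v2].
split; first by rewrite mulrACA -expCD subrr expC0 mulr1 expr2.
  by rewrite modCM mulrC ler_pM2r ?modC_branch// modC_expC h.
by rewrite modCM mulrC ler_pM2r ?modC_branch// modC_expC reCN h//; lra.
Qed.

Lemma strip_level_lt v : `|reC v| < ln 2 -> on_level c (c * expC v) (c * expC (- v)).
Proof. by move=> vr; apply: strip_level; apply: (le_trans (ltW vr)); rewrite lerDl. Qed.

Lemma param_mul v : (param v).1 * (param v).2 = c ^+ 2 * expC (2 * height v).
Proof.
have e1 := expC_neq0 v; rewrite /param /lift /= !mul1r.
by rewrite (_ : 2 * height v = height v + height v) ?expCD ?expCN; [field|ring].
Qed.

Lemma param_div v : (param v).1 / (param v).2 = expC (2 * v).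
Proof.
have cN : c != 0 by rewrite -modC_gt0 modC_branch.
have e1 := expC_neq0 v; have e2 := expC_neq0 (height v).
have -> : 2 * v = v + v by ring.
rewrite /param /lift /= !mul1r expCD expCN; field.
by rewrite e1 e2 cN.
Qed.

Lemma param_curve v : `|reC v| < ln 2 -> curve j (param v).
Proof.
move=> vr; have lv := strip_level_lt vr; have [hk hd _] := solP lv.
have cN : 0 < modC c by rewrite modC_branch.
have exp2 (u : R) : u < ln 2 -> expR u < 2.
  by move=> xl; rewrite -{1}(@lnK R 2) ?posrE// ltr_expR.
have [h2 _] := modC_exp_half hk.
have side u : modC (expC u) <= 2 ->
    0 < modC (c * expC u * expC (1%:R * height v)) < eps * (n%:R : R) `^ (- (2 * s)%:R^-1).
  move=> u2; rewrite mul1r (modCM (c * _)) (modCM c) modC_branch//.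
  rewrite !mulr_gt0 ?modC_gt0 ?expC_neq0//=.
  apply: le_lt_trans c0_eps; rewrite -mulrA mulrC ler_pM2r//.
  by rewrite (_ : 4 = 2 * 2) ?ler_pM ?modC_ge0//; ring.
move: (vr); rewrite ltr_norml => /andP[v1 v2].
split; [split; last split|exact: hd|by exists (height v) => //; exact: param_mul].
- by apply: side; rewrite modC_expC ltW// exp2.
- by apply: side; rewrite modC_expC reCN ltW// exp2//; lra.
by rewrite param_div expCMn modCX modC_expC expR_sqr_bounds.
Qed.

(** Any logarithm serves for [v]: the strip constrains only its real part. Uniqueness of the
    solution then identifies [t] with the height. *)
Lemma curve_param z : curve j z -> exists2 v : C, `|reC v| < ln 2 & z = param v.
Proof.
move=> [Oz dz [t tk tE]]; have [z1 z2 _] := Omega_bound n_gt0 eps_gt0 Oz.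
have cN : c != 0 by rewrite -modC_gt0 modC_branch.
have e1 := expC_neq0 t.
have [|v vE] := @expC_surj R (z.1 / (c * expC t)); first by rewrite mulf_neq0 ?invr_eq0// mulf_neq0.
have z1E : z.1 = c * expC v * expC t by rewrite vE; field; rewrite e1 cN.
have e2 := expC_neq0 v.
have z2E : z.2 = c * expC (- v) * expC t.
  apply: (mulfI z1); rewrite tE z1E expCN (_ : 2 * t = t + t); last by ring.
  by rewrite expCD; field.
have qE : z.1 / z.2 = expC (2 * v).
  rewrite z1E z2E expCN (_ : 2 * v = v + v); last by ring.
  by rewrite expCD; field; rewrite e1 e2 cN.
have vr : `|reC v| < ln 2.
  by move: Oz => [_ [_]]; rewrite qE expCMn modCX modC_expC expR_sqr_bounds.
exists v => //; have [_ _ uniq] := solP (strip_level_lt vr).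
have zE : z = lift 1 1 (c * expC v) (c * expC (- v)) t.
  by rewrite /lift mul1r -z1E -z2E -surjective_pairing.
by rewrite /param /height -(uniq t tk) -?zE.
Qed.

(** The direction [d] is 1 for continuity on the strip and [iC] for the real curve, which follows
    the imaginary axis. *)
Lemma upoly_param v d : `|reC v| <= ln 2 -> modC d <= 1 ->
  upoly 4^-1 (fun w => (param (v + d * w)).1) /\ upoly 4^-1 (fun w => (param (v + d * w)).2).
Proof.
move=> vr d1.
have lP : upoly 4^-1 (fun w => v + d * w).
  apply: upolyD; first exact: upoly_cst.
  by apply: upolyM; [exact: upoly_cst|exact: upoly_id].
have XP : upoly 4^-1 (fun w => c * expC (v + d * w)).
  by apply: upolyM; [exact: upoly_cst|exact: upoly_exp].
have YP : upoly 4^-1 (fun w => c * expC (- (v + d * w))).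
  by apply: upolyM; [exact: upoly_cst|apply/upoly_exp/upolyN].
have SP : upoly 4^-1 (fun w => height (v + d * w)).
  apply: sol_upoly => // w wr; apply: strip_level; rewrite reCD.
  apply: (le_trans (ler_normD _ _)); apply: lerD => //.
  apply: (le_trans (re_le_modC _)); rewrite modCM; have := modC_ge0 d; have := modC_ge0 w; nra.
exact: upoly_lift.
Qed.

Lemma continuous_param v : `|reC v| <= ln 2 -> {for v, continuous param}.
Proof.
move=> vr; have d1 : modC (1 : C) <= 1 by rewrite modC1.
have [p1 p2] := upoly_param vr d1.
have q0 : 0 < 4^-1 :> R by rewrite invr_gt0.
have e w : modC w <= 4^-1 -> v + 1 * w = v + w by rewrite mul1r.
have {}p1 : upoly 4^-1 (fun w => (param (v + w)).1).
  by apply: eq_upoly p1 => w /e ->.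
have {}p2 : upoly 4^-1 (fun w => (param (v + w)).2).
  by apply: eq_upoly p2 => w /e ->.
have c1 := upoly_continuous (g := fun w => (param w).1) q0 p1.
have c2 := upoly_continuous (g := fun w => (param w).2) q0 p2.
exact: (cvg_pair c1 c2).
Qed.

(** The strip is star-shaped about 0, so the curve is a union of images of segments through the
    common point [param 0]. *)
Lemma curve_connected : connected (curve j).
Proof.
have l2 : 0 < ln 2 :> R by rewrite ln_gt0// ltr1n.
pose path v := (fun t : R => param (ofR t * v)) @` `[0, 1].
have -> : curve j = \bigcup_(v in [set v : C | `|reC v| < ln 2]) path v.
  apply/seteqP; split => z.
    move=> /curve_param[v vr ->]; exists v => //; exists 1; first by rewrite /= in_itv /= ler01 lexx.
    by rewrite mul1r.
  move=> [v /= vr [t]]; rewrite /= in_itv /= => /andP[t0 t1] <-; apply: param_curve.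
  rewrite reCM /= mul0r subr0 normrM (ger0_norm t0); apply: le_lt_trans vr.
  by rewrite ler_piMl.
apply: bigcup_connected.
  exists (param 0) => v _; exists 0; first by rewrite /= in_itv /= lexx ler01.
  by rewrite mul0r.
move=> v /= vr; apply: connected_continuous_connected; first exact: segment_connected.
apply: continuous_in_subspaceT => t; rewrite inE /= in_itv /= => /andP[t0 t1].
apply: (@continuous_comp _ _ _ (fun t : R => ofR t * v) param); first exact: continuous_line.
apply: continuous_param; rewrite reCM /= mul0r subr0 normrM (ger0_norm t0).
by apply: le_trans (ltW vr); rewrite ler_piMl.
Qed.

Lemma curve_nonempty : curve j !=set0.
Proof.
by exists (param 0); apply: param_curve; rewrite normr0 ln_gt0// ltr1n.
Qed.

End Parametrization.

Lemma curves_union : union_of_holomorphic_curves s (fixed_set `&` Omega_set s n eps).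
Proof.
exists (fun i : 'I_s => curve i); split=> [i|].
  have [sol [solP sol_upoly]] := solve_defect (branch_scale i) (erefl : (1 + 1 = 2)%N).
  split; first exact: curve_nonempty solP.
  by split; [exact: curve_connected solP sol_upoly|exact: curve_holomorphic].
split=> [i k ik|z]; first by apply: curve_disjoint => //.
exact: fixed_curves.
Qed.

(** * The real curve of a reversible map *)

Definition reversible := forall z, phi_dom r p z ->
  phi_dom r p (rho z) /\ phi alpha s p (rho z) = rho (phi alpha s p z).

Lemma fixed_rho z : reversible -> fixed_set z -> fixed_set (rho z).
Proof.
move=> sym [dz fz].
have it k : (k <= n)%N -> iter k (phi alpha s p) (rho z) = rho (iter k (phi alpha s p) z).
  elim: k => [//|k ih kn]; rewrite !iterS ih; last exact: ltnW.
  by have [_] := sym _ (dz k kn).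
split=> [k kn|]; last by rewrite it// fz.
by rewrite it ?(ltnW kn)//; have [] := sym _ (dz k kn).
Qed.

Lemma Omega_rho z : Omega_set s n eps z -> Omega_set s n eps (rho z).
Proof.
move=> [/andP[a1 a2] [/andP[b1 b2] /andP[q1 q2]]].
rewrite /Omega_set /= !modC_conj modCM modCV !modC_conj a1 a2 b1 b2; do !split => //.
move: q1 q2; rewrite modCM modCV !ltr_pdivrMr// !ltr_pdivlMr// => q1 q2.
by apply/andP; split; lra.
Qed.

Lemma branch0 : branch c0 0 = ofR c0.
Proof. by rewrite /branch mulr0 mul0r ofR0 mulr0 expC0 mulr1. Qed.

Section RealCurve.
Variable sol : C -> C -> C.
Local Notation c := (branch c0 0).
Hypothesis solP : forall x y, on_level c x y -> [/\ modC (sol x y) <= kap / 2,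
  defect B n (lift 1 1 x y (sol x y)) = 0 &
  forall t, modC t <= kap / 2 -> defect B n (lift 1 1 x y t) = 0 -> t = sol x y].
Hypothesis sol_upoly : forall rho X Y, upoly rho X -> upoly rho Y ->
  (forall w, modC w <= rho -> on_level c (X w) (Y w)) -> upoly rho (fun w => sol (X w) (Y w)).
Hypothesis sym : reversible.

Local Notation height_i t := (height 0 sol (iC R * ofR t)).
Definition gam (t : R) : C * C := param 0 sol (iC R * ofR t).

Lemma strip_i (t : R) : `|reC (iC R * ofR t : C)| < ln 2.
Proof. by rewrite reC_iM normr0 ln_gt0// ltr1n. Qed.

Lemma conjC_i (t : R) : conjC (iC R * ofR t) = - (iC R * ofR t).
Proof. by apply: complexP; rewrite /= ?mul0r ?mulr0 ?mul1r; ring. Qed.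

(* The reflection fixes the parameter [i t] and conjugates the height, so
   uniqueness of the solution makes the height real. *)
Lemma height_real t : conjC (height_i t) = height_i t.
Proof.
set v := iC R * ofR t; have vr : `|reC v| < ln 2 := strip_i t.
have cz := param_curve solP vr; have [Oz dz _] := cz.
have fz : fixed_set (param 0 sol v) by apply/fixed_defect.
have dr : defect B n (rho (param 0 sol v)) = 0.
  by apply/fixed_defect; [exact: Omega_rho|exact: fixed_rho].
have [hk _ uniq] := solP (strip_level_lt 0 vr).
apply: uniq; first by rewrite modC_conj.
have <- : rho (param 0 sol v) = lift 1 1 (c * expC v) (c * expC (- v)) (conjC (height 0 sol v)).
  rewrite /rho /param /lift /= !mul1r branch0 !conjCM !conjC_expC conjC_ofR.
  have -> : conjC (- v) = v.
    by rewrite -[in LHS]conjC_i conjCK.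
  by rewrite conjC_i.
exact: dr.
Qed.

Definition radius t : R := c0 * expR (reC (height_i t)).

Lemma radius_gt0 t : 0 < radius t.
Proof. by rewrite mulr_gt0// expR_gt0. Qed.

(** Since the height is real, the curve is a polar graph with positive radius; simplicity over one
    period and regularity follow from this form. *)
Lemma gam_polar t : gam t = (ofR (radius t) * expC (iC R * ofR t), ofR (radius t) * expC (- (iC R * ofR t))).
Proof.
rewrite /gam /param /lift /= !mul1r (conjC_real (height_real t)) expC_ofR branch0 /radius ofRM.
by congr pair; ring.
Qed.

Lemma gam_fst t : (gam t).1 = ofR (radius t) * expC (iC R * ofR t).
Proof. by rewrite gam_polar. Qed.

Lemma gam_snd t : (gam t).2 = ofR (radius t) * expC (- (iC R * ofR t)).
Proof. by rewrite gam_polar. Qed.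

Lemma gam_real t : totally_real_plane (gam t).
Proof.
rewrite -[totally_real_plane _]/((gam t).2 = conjC (gam t).1) gam_fst gam_snd.
by rewrite conjCM conjC_ofR conjC_expC conjC_i.
Qed.

Lemma gam_curve t : curve 0 (gam t).
Proof. by rewrite /gam; exact: (param_curve solP (strip_i t)). Qed.

Lemma expC_i_period t : expC (iC R * ofR (t + 2 * pi)) = expC (iC R * ofR t).
Proof.
rewrite ofRD mulrDr expCD; have := @expC_2pi R 1.
by rewrite mul1r => ->; rewrite mulr1.
Qed.

Lemma gam_period t : gam (t + 2 * pi) = gam t.
Proof.
by rewrite /gam /param /height !expCN expC_i_period.
Qed.

Lemma gam_inj (t u : R) : 0 <= t < 2 * pi -> 0 <= u < 2 * pi -> gam t = gam u -> t = u.
Proof.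
move=> /andP[t0 t1] /andP[u0 u1]; move=> /(congr1 (@fst C C)).
rewrite !gam_fst => e.
have rE : radius t = radius u.
  have := congr1 (@modC R) e; rewrite !modCM !modC_ofR !modC_expC_i !mulr1.
  by rewrite !gtr0_norm ?radius_gt0.
have rN : ofR (radius u) != 0 :> C by rewrite -modC_eq0 modC_ofR normr_eq0 gt_eqF// radius_gt0.
move: e; rewrite rE => /(mulfI rN) e.
have {}e : expC (iC R * ofR (t - u)) = 1.
  by rewrite ofRD ofRN mulrDr mulrN expCB e divff// expC_neq0.
have [k kE] := expC_eq1 e; have := congr1 (@imC R) kE; rewrite !imC_iM => {}kE.
have pi0 := pi_gt0 R; have p2 : 0 < 2 * pi :> R by rewrite mulr_gt0.
have k1 : (k < 1)%R.
  rewrite -(ltr_int R) -(ltr_pM2r p2) -kE mul1r; lra.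
have k2 : (-1 < k)%R.
  rewrite -(ltr_int R) -(ltr_pM2r p2) -kE rmorphN mulN1r; lra.
have k0 : k = 0 by clear -k1 k2; lia.
by move: kE; rewrite k0 mul0r; lra.
Qed.

Lemma gam_local t : exists F1 F2, [/\ upoly 4^-1 F1, upoly 4^-1 F2 &
  forall u, gam u = (F1 (ofR (u - t)), F2 (ofR (u - t)))].
Proof.
have d1 : modC (iC R) <= 1 by rewrite modC_iC.
have [P1 P2] := upoly_param sol_upoly (ltW (strip_i t)) d1.
exists (fun w => (param 0 sol (iC R * ofR t + iC R * w)).1).
exists (fun w => (param 0 sol (iC R * ofR t + iC R * w)).2); split => // u.
by rewrite -mulrDr -ofRD addrC subrK -surjective_pairing.
Qed.

(** The identity [Im * cos - Re * sin = 0] holds along the curve. If both derivatives vanished,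
    differentiating it would leave [- radius t = 0]; the derivative of the radius never appears. *)
Lemma gam_regular t : (fun u => reC (gam u).1)^`() t != 0 \/ (fun u => imC (gam u).1)^`() t != 0.
Proof.
have [F1 [F2 [P1 _ gE]]] := gam_local t.
have q0 : 0 < 4^-1 :> R by rewrite invr_gt0.
have [|d [dre dim]] := @upoly_line R F1 (fun u => (gam u).1) t 4^-1 q0 P1.
  by move=> u _; rewrite gE.
have -> : (fun u => reC (gam u).1)^`() t = reC d by rewrite derive1E derive_val.
have -> : (fun u => imC (gam u).1)^`() t = imC d by rewrite derive1E derive_val.
have [dr0|] := eqVneq (reC d) 0; last by left.
have [di0|] := eqVneq (imC d) 0; last by right.
exfalso; rewrite dr0 in dre; rewrite di0 in dim.
have reE u : reC (gam u).1 = radius u * cos u.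
  by rewrite gam_fst reCM re_expC im_expC reC_iM imC_iM expR0 /= mul0r subr0 mul1r.
have imE u : imC (gam u).1 = radius u * sin u.
  by rewrite gam_fst imCM re_expC im_expC reC_iM imC_iM expR0 /= mul0r addr0 mul1r.
have z : (fun u => imC (gam u).1) * cos - (fun u => reC (gam u).1) * sin = cst 0.
  by apply/funext => u; rewrite !fctE reE imE /=; ring.
have D := is_deriveB (is_deriveM dim (is_derive_cos t)) (is_deriveM dre (is_derive_sin t)).
have := @derive_val _ _ _ _ _ _ _ D.
rewrite z derive_cst reE imE !scaler0 !addr0 => h.
have rt := radius_gt0 t; have cs := cos2Dsin2 t.
have : radius t * (cos t ^+ 2 + sin t ^+ 2) = 0.
  have {}h : 0 = radius t * sin t * - sin t - radius t * cos t * cos t by exact: h.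
  by rewrite -[RHS]oppr0 [in RHS]h; ring.
by rewrite cs mulr1 => r0; move: rt; rewrite r0 ltxx.
Qed.

(* On the totally real plane [xi eta = |xi|^2 > 0], which selects the branch
   [j = 0]. *)
Lemma real_curve j z : (j < s)%N -> curve j z -> z.2 = conjC z.1 -> exists t, z = gam t.
Proof.
move=> js cz z2E; have [Oz dz [t tk tE]] := cz.
have [z1 z2 _] := Omega_bound n_gt0 eps_gt0 Oz.
have cN : ofR (c0 ^+ 2) != 0 :> C.
  by rewrite -modC_eq0 modC_ofR normr_eq0 expf_neq0// gt_eqF.
(* A logarithm of the positive number [z.1 z.2 / c0^2]; its imaginary part is therefore a multiple
   of [2 pi]. *)
set W : C := iC R * ofR (2 * pi * j%:R / s%:R) + 2 * t.
have WE : expC W = ofR (modC z.1 ^+ 2 / c0 ^+ 2).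
  apply: (mulfI cN); rewrite /W expCD mulrA -branch_sqr -tE z2E mul_conjC -ofRM.
  by congr ofR; field; rewrite gt_eqF.
have Wm : expR (reC W) = modC z.1 ^+ 2 / c0 ^+ 2.
  by rewrite -modC_expC WE modC_ofR ger0_norm// divr_ge0// exprn_ge0// ?modC_ge0// ltW.
have W1 : expC (W - ofR (reC W)) = 1.
  by rewrite expCB expC_ofR Wm WE divff// -WE expC_neq0.
have [k kE] := expC_eq1 W1.
have j0 : j = 0%N.
  apply: (@branch_angle j k (imC t) js).
    by apply: (le_trans (im_le_modC _)); apply: (le_trans tk); exact: kap_half.
  have := congr1 (@imC R) kE; rewrite imC_iM (imCD W) imCN /= oppr0 addr0 => <-.
  rewrite /W (imCD (iC R * ofR _)) imC_iM.
  suff -> : imC (2 * t) = 2 * imC t by [].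
  by rewrite -(@ofR_nat R 2) imCM /= -/(imC t); ring.
rewrite j0 in cz; have [v vr zE] := curve_param solP cz.
exists (imC v); rewrite zE /gam; congr (param 0 sol _).
(* On the real plane the ratio of the coordinates has modulus 1, which puts [v] on the imaginary
   axis. *)
have q : modC (expC (2 * v)) = 1.
  rewrite -(param_div 0 sol v) -zE z2E modCM modCV modC_conj divff//.
  by rewrite modC_eq0.
have re0 : reC v = 0.
  move: q; rewrite expCMn modCX modC_expC -expRM_natl -{2}expR0 => /expR_inj; lra.
by apply: complexP; rewrite ?reC_iM ?imC_iM.
Qed.

End RealCurve.

Lemma fixed_real_curve : reversible -> closed_real_analytic_curve
  (fixed_set `&` Omega_set s n eps `&` totally_real_plane (R := R)).
Proof.
move=> sym.
have [sol [solP sol_upoly]] := solve_defect (branch_scale 0) (erefl : (1 + 1 = 2)%N).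
exists (gam sol), (2 * pi); split; first by rewrite mulr_gt0 ?pi_gt0.
split; first exact: gam_period.
split; first by move=> t u tp up; exact: (gam_inj solP sym tp up).
have q0 : 0 < 4^-1 :> R by rewrite invr_gt0.
have [r1 i1] : real_analytic (fun t => reC (gam sol t).1) /\ real_analytic (fun t => imC (gam sol t).1).
  apply: (@upoly_real_analytic R (fun t => (gam sol t).1)) => t.
  have [F1 [F2 [P1 _ gE]]] := gam_local sol_upoly t.
  by exists F1, 4^-1; split => // u _; rewrite gE.
have [r2 i2] : real_analytic (fun t => reC (gam sol t).2) /\ real_analytic (fun t => imC (gam sol t).2).
  apply: (@upoly_real_analytic R (fun t => (gam sol t).2)) => t.
  have [F1 [F2 [_ P2 gE]]] := gam_local sol_upoly t.
  by exists F2, 4^-1; split => // u _; rewrite gE.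
do 4!split => //; split.
  by move=> t; have [h|h] := gam_regular solP sol_upoly sym t; [left|right; left].
move=> z; split=> [[/fixed_curves[j cz] zr]|[t ->]].
  exact: (real_curve solP (ltn_ord j) cz).
split; last exact: gam_real solP sym t.
by apply/fixed_curves; exists (Ordinal s_gt0); exact: gam_curve solP t.
Qed.

End Curves.
End Dynamics.

(** * Choice of the constants and conclusion *)

Lemma root_exists (R : realType) (s n : nat) (B : R) : (0 < s)%N -> (0 < n)%N -> 0 < B ->
  exists2 c0 : R, 0 < c0 & n%:R * c0 ^+ (2 * s) = B.
Proof.
move=> s0 n0 B0; have nR : 0 < n%:R :> R by rewrite ltr0n.
have q0 : 0 < B / n%:R by rewrite divr_gt0.
exists ((B / n%:R) `^ (2 * s)%:R^-1); first exact: powR_gt0.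
rewrite -powR_mulrn ?powR_ge0// -powRrM mulVf ?pnatr_eq0 ?muln_eq0 ?(gtn_eqF s0)//.
by rewrite powRr1 ?ltW// mulrC divfK// gt_eqF.
Qed.

Theorem theorem2p3 (R : realType) (s : nat) (r m0 : R) :
  (0 < s)%N -> 0 < r < 1 -> 0 < m0 ->
  exists eps delta : R, 0 < eps /\ 0 < delta /\
  forall (alpha : R) (a : nat -> nat -> Cplx R) (p : Cplx R * Cplx R -> Cplx R),
    (* p is a power series with terms of order >= 2s+1 ... *)
    (forall i j, (i + j < 2 * s + 1)%N -> a i j = 0) ->
    (* ... converging (absolutely) on Delta_r ... *)
    (forall z, bidisk r z -> exists M : R, forall N, abs_psum2 a z.1 z.2 N <= M) ->
    (forall z, bidisk r z -> (fun N => psum2 a z.1 z.2 N) @ \oo --> p z) ->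
    (* ... with ||p||_r <= m0 *)
    (forall z, bidisk r z -> modC (p z) <= m0) ->
    forall n : nat, (0 < n)%N ->
    forall (g : int) (beta : R),
      n%:R * alpha = 2 * g%:~R * pi + beta -> - pi < beta < pi ->
      - delta < beta < 0 ->
      union_of_holomorphic_curves s
        (fixed_iter (phi_dom r p) (phi alpha s p) n `&` Omega_set s n eps) /\
      ((forall z, phi_dom r p z ->
          phi_dom r p (rho z) /\ phi alpha s p (rho z) = rho (phi alpha s p z)) ->
       closed_real_analytic_curve
         (fixed_iter (phi_dom r p) (phi alpha s p) n `&` Omega_set s n eps
            `&` totally_real_plane (R := R))).
Proof.
move=> s0 /andP[r0 r1] m00.
have s2 : (0 < 2 * s)%N by rewrite muln_gt0.
(* The Schwarz bound [2 m0 (2 b / r)^(2s+1)] of [psum2_small], with the power of [b] taken out. *)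
have [Cp CpE] : exists Cp : R, Cp = 2 * m0 * (2 / r) ^+ (2 * s).+1 by eexists.
have Cp0 : 0 < Cp by rewrite CpE mulr_gt0 ?mulr_gt0 ?exprn_gt0 ?divr_gt0//.
pose K := local_constant s Cp.
have K0 : 0 < K by rewrite /K /local_constant !mulr_gt0 ?exprn_gt0//.
pose K' := 32 * (32 * K).
have K'0 : 0 < K' by rewrite /K' mulr_gt0 ?mulr_gt0//.
(* One bound for each clause of [eps_small]. *)
pose eps := Num.min 4^-1 (Num.min (r / 8) K'^-1).
have eps0 : 0 < eps by rewrite /eps !lt_min; apply/and3P; split; rewrite ?invr_gt0 ?divr_gt0.
have [eps4 [epsr epsK]] : eps <= 4^-1 /\ eps <= r / 8 /\ eps <= K'^-1.
  by rewrite /eps !ge_min !lexx /= !orbT.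
pose D := 2 ^+ 15 * Cp * 32 ^+ (2 * s).+1.
have D0 : 0 < D by rewrite /D !mulr_gt0 ?exprn_gt0//.
(* The two bounds on [|c|] required by [scale]. *)
pose c2 := Num.min (r / 128) D^-1.
have c20 : 0 < c2 by rewrite /c2 lt_min; apply/andP; split; rewrite ?invr_gt0 ?divr_gt0.
have [c2r c2D] : c2 <= r / 128 /\ c2 <= D^-1 by rewrite /c2 !ge_min !lexx /= !orbT.
(* The first bound serves [localization], the second [scale]. As [c0^(2s) <= n c0^(2s) = B < delta],
   the third gives [c0 <= c2]; the last gives [4 c0 < eps n^(-1/(2s))] after multiplying [2s]-th
   powers by [n]. *)
pose delta := Num.min (16^-1 : R) (Num.min (4 * 256 ^+ s)^-1
  (Num.min (c2 ^+ (2 * s)) ((eps / 4) ^+ (2 * s)))).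
have delta0 : 0 < delta.
  by rewrite /delta !lt_min; apply/and4P; split; rewrite ?invr_gt0 ?exprn_gt0 ?mulr_gt0 ?exprn_gt0 ?divr_gt0.
have [d1 [d2 [d3 d4]]] : delta <= 16^-1 /\ delta <= (4 * 256 ^+ s)^-1 /\
    delta <= c2 ^+ (2 * s) /\ delta <= (eps / 4) ^+ (2 * s).
  by rewrite /delta !ge_min !lexx /= !orbT.
exists eps, delta; split=> //; split=> // alpha a p a0 absP cvP pM n n0 g beta nab _ /andP[b1 b2].
pose B := - beta; have B0 : 0 < B by rewrite oppr_gt0.
have Bd : B < delta by rewrite /B ltrNl.
have [c0 c00 nc0] := root_exists s0 n0 B0.
have nR : 1 <= n%:R :> R by rewrite ler1n.
have c0B : c0 ^+ (2 * s) <= B.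
  by rewrite -nc0 ler_peMl// exprn_ge0// ltW.
have c0c2 : c0 <= c2.
  rewrite -(@ler_pXn2r _ (2 * s)) ?nnegrE ?(ltW c00) ?(ltW c20)//.
  exact: (le_trans c0B (le_trans (ltW Bd) d3)).
have [N0 NE] := root_n R s0 n0.
have c0e : 4 * c0 < eps * (n%:R : R) `^ (- (2 * s)%:R^-1).
  set N1 := _ `^ _ in N0 NE *.
  rewrite -ltr_pdivlMl// mulrA (mulrC _ eps) -(@ltr_pXn2r _ (2 * s)) ?nnegrE ?(ltW c00)//; last first.
    by rewrite mulr_ge0 ?(ltW N0)// divr_ge0 ?(ltW eps0).
  have nR0 : 0 < n%:R :> R by rewrite ltr0n.
  by rewrite -(ltr_pM2l nR0) nc0 exprMn mulrCA NE mulr1 (lt_le_trans Bd).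
have sc j : scale s r Cp n B (branch s c0 j).
  split => //.
  - by rewrite B0 (le_trans (ltW Bd)).
  - by rewrite modC_branch// -ler_pdivlMl// mulrC (le_trans c0c2).
  - by rewrite modC_branch// -/D -ler_pdivlMl// mulr1 (le_trans c0c2).
  - by rewrite branch_exp2s// -(@ofR_nat R) -ofRM nc0.
have epsok : eps_small s r Cp eps.
  split; first by rewrite eps0.
    by rewrite -ler_pdivlMl// mulrC.
  have -> : 32 * (32 * (local_constant s Cp * eps)) = K' * eps by rewrite /K' /K; ring.
  by rewrite -ler_pdivlMl// mulr1.
have pU b rho X Y : b < r -> upoly rho X -> upoly rho Y ->
    (forall w, modC w <= rho -> modC (X w) <= b /\ modC (Y w) <= b) ->
    upoly rho (fun w => p (X w, Y w)).
  by move=> br; exact: upoly_psum2_lim br absP cvP.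
have a0' i j : (i + j < (2 * s).+1)%N -> a i j = 0 by rewrite -[(2 * s).+1]addn1; exact: a0.
have pS b : 0 < b -> 4 * b <= r -> forall x y, modC x <= b -> modC y <= b ->
    modC (p (x, y)) <= Cp * b ^+ (2 * s).+1.
  move=> b0 br x y xb yb; have := psum2_small a0' absP cvP pM b0 br xb yb.
  by rewrite CpE -(mulrA _ _ (b ^+ _)) -exprMn (mulrAC 2 b).
have B16 : 0 < B <= 16^-1 by rewrite B0 (le_trans (ltW Bd)).
have nab' : n%:R * alpha = 2 * g%:~R * pi - B by rewrite nab opprK.
split; first exact: (curves_union pU pS s0 (ltW Cp0) n0 B16 c00 nc0 sc epsok c0e nab').
exact: (fixed_real_curve pU pS s0 (ltW Cp0) n0 B16 c00 nc0 sc epsok c0e nab').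
Qed.
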